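(* Let $p$ be a prime, $k$ a field of characteristic $p$, and $G$ a finite group. If $G$ is $p$-isolated, then the Green functor $\underline{S}_k$ satisfies induction with respect to the family $\mathcal{F}_p$ of $p$-subgroups of $G$; that is, the sum of induction maps $$\bigoplus_{H\in\mathcal{F}_p}\underline{S}_k(H)\xrightarrow{\ \bigoplus\mathrm{Ind}_H^G\ }\underline{S}_k(G)$$ is surjective.
   Context: A finite group $G$ is $p$-isolated if it contains no element of order $pq$ for $q$ a prime distinct from $p$. For $H\le G$, let $\underline{P}_k(H)=\mathrm{K}_0(kH)$ be the Grothendieck group of finitely generated projective $kH$-modules and $\underline{R}_k(H)=\mathrm{G}_0(kH)$ the Grothendieck group of finite-dimensional $kH$-modules (the representation ring). The Cartan homomorphism $\underline{P}_k(H)\to\underline{R}_k(H)$, induced by the inclusion of projectives into all modules, is injective. $\underline{S}_k(H)$ is its cokernel, $\underline{S}_k(H)=\underline{R}_k(H)/\underline{P}_k(H)$; equivalently, $\underline{S}_k(H)=\pi_0$ of the K-theory of the stable module category of $kH$. Induction, restriction and conjugation of representations, together with the tensor product over $k$, make $H\mapsto\underline{R}_k(H)$ a Green functor for $G$ in which $\underline{P}_k$ is a Green ideal, so that $\underline{S}_k$ is a quotient Green functor; $\mathrm{Ind}_H^G:\underline{S}_k(H)\to\underline{S}_k(G)$ is induced by induction of representations. *)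

(* Defs.v *)
From HB Require Import structures.
From mathcomp Require Import all_boot all_order all_algebra all_fingroup.
From mathcomp Require Import all_solvable all_field all_character.
From mathcomp Require Import boolp classical_sets.
From mathcomp Require Import freeg.

Set Implicit Arguments.
Unset Strict Implicit.
Unset Printing Implicit Defensive.

Import GroupScope GRing.Theory.
Local Open Scope ring_scope.

Definition p_isolated (p : nat) (gT : finGroupType) (G : {set gT}) : Prop :=
  forall x q, x \in G -> prime q -> q != p -> #[x]%g <> (p * q)%N.

(* [quotz A] is the quotient of the abelian group [V] by the subgroup
   [zgen A] generated by the subset [A].                                    *)
Section QuotientByGenerated.

Variables (V : zmodType) (A : set V).

Inductive zgen : V -> Prop :=
| zgen_gen x of A x : zgen x
| zgen0 : zgen 0
| zgenB x y of zgen x & zgen y : zgen (x - y).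

Definition zgen_pred : {pred V} := fun x => `[< zgen x >].

Lemma zgen_predP x : reflect (zgen x) (x \in zgen_pred).
Proof. exact: asboolP. Qed.

Fact zgen_zmod_closed : zmod_closed zgen_pred.
Proof.
split=> [|x y]; first by apply/zgen_predP; exact: zgen0.
by move=> /zgen_predP xA /zgen_predP yA; apply/zgen_predP; exact: zgenB.
Qed.
HB.instance Definition _ :=
  GRing.isZmodClosed.Build V zgen_pred zgen_zmod_closed.

Definition quotz := Quotient.quot zgen_pred.
HB.instance Definition _ := GRing.Zmodule.on quotz.

Definition quotz_pi (x : V) : quotz := (\pi_(Quotient.quot zgen_pred) x)%qT.

Fact quotz_pi_is_zmod_morphism : zmod_morphism quotz_pi.
Proof. exact: (raddfB \pi_(Quotient.quot zgen_pred)%qT). Qed.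
HB.instance Definition _ :=
  GRing.isZmodMorphism.Build V quotz quotz_pi quotz_pi_is_zmod_morphism.

Lemma quotz_pi_eq x y : quotz_pi x = quotz_pi y <-> zgen (x - y).
Proof.
split=> [/eqP | xyA].
  by rewrite /quotz_pi -Quotient.idealrBE => /zgen_predP.
by apply/eqP; rewrite /quotz_pi -Quotient.idealrBE; apply/zgen_predP.
Qed.

Lemma quotz_pi_surj (y : quotz) : exists x, quotz_pi x = y.
Proof. by exists (generic_quotient.repr y); rewrite /quotz_pi reprK. Qed.

(* The map induced on [quotz A] by [f]; it is meaningful when the additive
   map [f] kills [A], as the hypothesis [fA] below requires.                *)
Definition quotz_lift (W : zmodType) (f : V -> W) (y : quotz) : W :=
  f (generic_quotient.repr y).

Variables (W : zmodType) (f : {additive V -> W}).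
Hypothesis fA : forall x, A x -> f x = 0.

Lemma zgen_ker x : zgen x -> f x = 0.
Proof.
by elim=> [y /fA // | | y z _ fy _ fz]; rewrite ?raddf0 // raddfB fy fz subrr.
Qed.

Lemma quotz_lift_pi x : quotz_lift f (quotz_pi x) = f x.
Proof.
apply/eqP; rewrite -subr_eq0 -raddfB; apply/eqP/zgen_ker/quotz_pi_eq.
by rewrite /quotz_pi reprK.
Qed.

Lemma quotz_lift_is_zmod_morphism : zmod_morphism (quotz_lift f).
Proof.
move=> u v; have [x <-] := quotz_pi_surj u; have [y <-] := quotz_pi_surj v.
by rewrite -raddfB !quotz_lift_pi raddfB.
Qed.

End QuotientByGenerated.

Section FreeLift.

Variables (K : choiceType) (M : zmodType) (f : K -> M).

Definition freez_gen (x : K) : {freeg K} := [freeg [:: (1, x)]].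

Definition freez_lift (D : {freeg K}) : M := fglift (f : K -> zmodule M) D.

Fact freez_lift_is_zmod_morphism : zmod_morphism freez_lift.
Proof. exact: (@lift_is_additive _ K (zmodule M) f). Qed.
HB.instance Definition _ :=
  GRing.isZmodMorphism.Build {freeg K} M freez_lift freez_lift_is_zmod_morphism.

Lemma freez_liftU x : freez_lift (freez_gen x) = f x.
Proof. by rewrite /freez_lift liftU scale1r. Qed.

End FreeLift.

(* A finite-dimensional kG-module is a [representation k G] (dimension 0
   allowed); only the matrices of elements of G are meaningful, the others
   play no role in [grepr_hom].  Representations act on row vectors, so a homomorphism V -> W
   is a matrix f acting by v |-> v *m f.                                    *)
Section Modules.

Variables (k : fieldType) (gT : finGroupType) (G : {group gT}).
Local Notation kGmod := (representation k G).
Implicit Types U V W P : kGmod.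

Definition grepr_hom V W (f : 'M[k]_(rdegree V, rdegree W)) : Prop :=
  {in G, forall x, V x *m f = f *m W x}.

Definition short_exact U V W
    (f : 'M[k]_(rdegree U, rdegree V)) (g : 'M[k]_(rdegree V, rdegree W)) :=
  [/\ grepr_hom f, grepr_hom g, row_free f, row_full g & (f == kermx g)%MS].

Definition free_grepr (n : nat) : kGmod :=
  muln_grepr (Representation (regular_repr k G)) n.

Definition projective P : Prop :=
  exists (n : nat) (i : 'M_(rdegree P, rdegree (free_grepr n)))
         (r : 'M_(rdegree (free_grepr n), rdegree P)),
    [/\ grepr_hom i, grepr_hom r & i *m r = 1%:M].

Definition lifting P : Prop :=
  forall V W (g : 'M_(rdegree V, rdegree W)) (h : 'M_(rdegree P, rdegree W)),
    grepr_hom g -> row_full g -> grepr_hom h ->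
  exists2 h' : 'M_(rdegree P, rdegree V), grepr_hom h' & h' *m g = h.

Lemma grepr_hom_mul U V W (f : 'M_(rdegree U, rdegree V))
    (g : 'M_(rdegree V, rdegree W)) :
  grepr_hom f -> grepr_hom g -> grepr_hom (f *m g).
Proof. by move=> hf hg x Gx; rewrite mulmxA hf // -!mulmxA hg. Qed.

Local Notation aG := (Representation (regular_repr k G)).

Definition orbit_mx V (v : 'rV[k]_(rdegree V)) : 'M_(#|G|, rdegree V) :=
  \matrix_(i < #|G|) (v *m V (enum_val i)).

Lemma orbit_mx_hom V (v : 'rV_(rdegree V)) :
  @grepr_hom aG V (orbit_mx v).
Proof.
move=> x Gx; apply/row_matrixP=> i; have Gi := enum_valP i.
rewrite !row_mul !rowK -rowE rowK gring_indexK ?groupM //.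
by rewrite repr_mxM // mulmxA.
Qed.

Lemma orbit_mx_sub V (v : 'rV_(rdegree V)) : (v <= orbit_mx v)%MS.
Proof.
have vE: row (gring_index G 1) (orbit_mx v) = v.
  by rewrite rowK gring_indexK // repr_mx1 mulmx1.
by rewrite -{1}vE row_sub.
Qed.

Lemma regular_homE V (f : 'M_(#|G|, rdegree V)) :
  @grepr_hom aG V f -> f = orbit_mx (row (gring_index G 1) f).
Proof.
move=> hf; apply/row_matrixP=> i; have Gi := enum_valP i.
rewrite rowK [in RHS]rowE -mulmxA -(hf _ Gi) mulmxA -rowE rowK.
by rewrite gring_indexK // mul1g gring_valK -rowE.
Qed.

Lemma lifting_regular : lifting aG.
Proof.
move=> V W g h hg full_g hh; pose w := row (gring_index G 1) h.
have /submxP[v wE]: (w <= g)%MS by exact: submx_full.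
exists (orbit_mx v); first exact: orbit_mx_hom.
rewrite (regular_homE hh) -/w wE; apply/row_matrixP=> i.
by rewrite row_mul !rowK -!mulmxA hg ?enum_valP.
Qed.

Lemma lifting0 : lifting grepr0.
Proof.
move=> V W g h _ _ _; exists 0; last by rewrite mul0mx [h]flatmx0.
by move=> x _; rewrite mulmx0 mul0mx.
Qed.

Lemma lifting_dadd P Q : lifting P -> lifting Q -> lifting (dadd_grepr P Q).
Proof.
move=> lP lQ V W g; rewrite /= => h hg full_g hh.
have hU: grepr_hom (usubmx h : 'M_(rdegree P, rdegree W))
      /\ grepr_hom (dsubmx h : 'M_(rdegree Q, rdegree W)).
  split=> x Gx; move: (hh x Gx); rewrite /= -[h]vsubmxK mul_block_col mul_col_mx;
  by rewrite !mul0mx addr0 add0r => /eq_col_mx[]; rewrite ?col_mxKu ?col_mxKd.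
have [hU1 hU2] := hU.
have [u hu uE] := lP V W g _ hg full_g hU1.
have [d hd dE] := lQ V W g _ hg full_g hU2.
exists (col_mx u d); last by rewrite mul_col_mx uE dE vsubmxK.
move=> x Gx; rewrite /= mul_block_col mul_col_mx !mul0mx addr0 add0r.
by rewrite hu // hd.
Qed.

Lemma lifting_free n : lifting (free_grepr n).
Proof.
rewrite /free_grepr /muln_grepr; apply: big_ind => [|P Q|_ _].
- exact: lifting0.
- exact: lifting_dadd.
exact: lifting_regular.
Qed.

Lemma free_cover V n (w : 'I_n -> 'rV[k]_(rdegree V)) :
  exists2 f : 'M_(rdegree (free_grepr n), rdegree V),
    grepr_hom f & forall i, (w i <= f)%MS.
Proof.
elim: n w => [|n IHn] w.
  by exists 0 => [x _|[]//]; rewrite mulmx0 mul0mx.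
have -> : free_grepr n.+1 = dadd_grepr aG (free_grepr n).
  by rewrite /free_grepr /muln_grepr big_ord_recl.
have [f hf wf] := IHn (fun i => w (fintype.lift ord0 i)).
exists (col_mx (orbit_mx (w ord0)) f : 'M_(rdegree (dadd_grepr aG _), _)).
  move=> x Gx; rewrite /= mul_block_col mul_col_mx !mul0mx addr0 add0r.
  by rewrite hf //; congr col_mx; exact: orbit_mx_hom.
move=> i; rewrite -addsmxE; case: (unliftP ord0 i) => [j|] ->.
  exact: submx_trans (wf j) (addsmxSr _ _).
exact: submx_trans (orbit_mx_sub _) (addsmxSl _ _).
Qed.

Lemma projectiveP P : projective P <-> lifting P.
Proof.
split=> [[n [i [r [hi hr ir1]]]] V W g h hg full_g hh | lP].
  have [h' hh' h'g] := lifting_free hg full_g (grepr_hom_mul hr hh).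
  exists (i *m h'); first exact: grepr_hom_mul.
  by rewrite -mulmxA h'g mulmxA ir1 mul1mx.
have [f hf wf] := free_cover (fun i => row i (1%:M : 'M[k]_(rdegree P))).
have full_f: row_full f by rewrite -sub1mx; apply/row_subP.
have [|s hs sf] := lP _ _ f 1%:M hf full_f.
  by move=> x Gx; rewrite mulmx1 mul1mx.
by exists (rdegree P), s, f.
Qed.

End Modules.

(* The Grothendieck group of the family of modules [m : T -> representation]:
   the free abelian group on T modulo the relations [V] = [U] + [W] for the
   short exact sequences 0 -> U -> V -> W -> 0 with terms in the family
   (0 -> U -> V -> 0 -> 0 identifies isomorphic modules).                   *)
Section Grothendieck.

Variables (k : fieldType) (gT : finGroupType) (G : {group gT}).
Variables (T : Type) (m : T -> representation k G).

Definition groth_rel : set {freeg {classic T}} :=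
  [set x | exists U V W f g,
     @short_exact _ _ G (m U) (m V) (m W) f g
     /\ x = freez_gen (V : {classic T}) - (freez_gen (U : {classic T})
                                        + freez_gen (W : {classic T}))].

Definition groth := quotz groth_rel.
HB.instance Definition _ := GRing.Zmodule.on groth.

Definition groth_class (V : T) : groth :=
  quotz_pi groth_rel (freez_gen (V : {classic T})).

Definition groth_lift (M : zmodType) (c : T -> M) : groth -> M :=
  quotz_lift (freez_lift (c : {classic T} -> M)).

Variables (M : zmodType) (c : T -> M).
Hypothesis c_exact : forall U V W f g,
  @short_exact _ _ G (m U) (m V) (m W) f g -> c V = c U + c W.

Let c_kill x : groth_rel x -> freez_lift (c : {classic T} -> M) x = 0.
Proof.
case=> U [V [W [f [g [/c_exact cV ->]]]]].
by rewrite raddfB raddfD /= !freez_liftU cV subrr.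
Qed.

Lemma groth_liftE V : groth_lift c (groth_class V) = c V.
Proof. by rewrite /groth_lift quotz_lift_pi //= freez_liftU. Qed.

Lemma groth_lift_is_zmod_morphism : zmod_morphism (groth_lift c).
Proof. exact: quotz_lift_is_zmod_morphism. Qed.

End Grothendieck.

Lemma groth_class_exact (k : fieldType) (gT : finGroupType) (G : {group gT})
    (T : Type) (m : T -> representation k G) U V W f g :
  @short_exact _ _ G (m U) (m V) (m W) f g ->
  groth_class m V = groth_class m U + groth_class m W.
Proof.
move=> ex; rewrite /groth_class -raddfD; apply/quotz_pi_eq/zgen_gen.
by exists U, V, W, f, g.
Qed.

Lemma groth_ind (k : fieldType) (gT : finGroupType) (G : {group gT})
    (T : Type) (m : T -> representation k G) (Q : groth m -> Prop) :
  Q 0 -> (forall y z, Q y -> Q z -> Q (y - z)) ->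
  (forall V, Q (groth_class m V)) -> forall x, Q x.
Proof.
move=> Q0 QB Qc x; have [D <-] := quotz_pi_surj x.
have QN y : Q y -> Q (- y) by rewrite -[- y]add0r; exact: QB.
have QD y z : Q y -> Q z -> Q (y + z).
  by move=> Qy Qz; rewrite -[z]opprK; apply/QB/QN.
have QMn y n : Q y -> Q (y *+ n).
  by move=> Qy; elim: n => [//|n IHn]; rewrite mulrS; exact: QD.
rewrite -[D]freeg_repr; elim: (FreegDefs.seq_of_prefreeg _) => [|[c V] s IHs].
  by rewrite freeg_nil raddf0.
rewrite -cat1s freeg_cat raddfD; apply: QD => //.
rewrite -[c]intz -freegU_mulz raddfMz /=.
by case: c => n; [|rewrite NegzE mulrNz; apply: QN]; exact/QMn/Qc.
Qed.

Section StableGroup.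

Variables (k : fieldType) (gT : finGroupType) (G : {group gT}).

(* [Rk] is G_0(kG), [Pk] is K_0(kG), and [Sk] the cokernel of the Cartan map. *)
Definition projrep := {P : representation k G | projective P}.
Definition projrep_val (P : projrep) : representation k G := sval P.

Definition Rk := groth (@id (representation k G)).
HB.instance Definition _ := GRing.Zmodule.on Rk.
Definition Rk_class (V : representation k G) : Rk := groth_class id V.

Definition Pk := groth projrep_val.
HB.instance Definition _ := GRing.Zmodule.on Pk.

Definition cartan : Pk -> Rk :=
  @groth_lift _ _ _ _ projrep_val Rk (fun P => Rk_class (projrep_val P)).

Let cartan_exact (U V W : projrep) f g :
  @short_exact _ _ G (projrep_val U) (projrep_val V) (projrep_val W) f g ->
  Rk_class (projrep_val V)
    = Rk_class (projrep_val U) + Rk_class (projrep_val W).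
Proof. exact: (@groth_class_exact _ _ G _ id). Qed.

Fact cartan_is_zmod_morphism : zmod_morphism cartan.
Proof. exact: groth_lift_is_zmod_morphism cartan_exact. Qed.
HB.instance Definition _ :=
  GRing.isZmodMorphism.Build Pk Rk cartan cartan_is_zmod_morphism.

Lemma cartanE (P : projrep) :
  cartan (groth_class projrep_val P) = Rk_class (projrep_val P).
Proof. exact: groth_liftE cartan_exact P. Qed.

Definition Sk := quotz (range cartan).
HB.instance Definition _ := GRing.Zmodule.on Sk.
Definition Sk_proj : Rk -> Sk := quotz_pi (range cartan).
HB.instance Definition _ := GRing.Additive.on Sk_proj.

End StableGroup.

(* Induction.  With t_i the chosen representatives of the right cosets of H
   in G, the (i, j) block of the action of x on V (x)_{kH} kG = (+)_i V (x) t_i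
   is the action of t_i x t_j^-1 on V if t_i x t_j^-1 is in H, and 0 if not. *)
Section Induction.

Variables (k : fieldType) (gT : finGroupType) (H G : {group gT}).
Hypothesis sHG : H \subset G.

Local Notation m := #|G : H|.

Definition coset_rep (i : 'I_m) : gT := repr (enum_val i : {set gT}).
Local Notation t := coset_rep.

Lemma coset_repE (i : 'I_m) : H :* t i = enum_val i :> {set gT}.
Proof.
have /rcosetsP[x Gx def_i] := enum_valP i.
by rewrite /t def_i rcoset_repr.
Qed.

Lemma coset_rep_in i : t i \in G.
Proof.
have /rcosetsP[x Gx def_i] := enum_valP i.
have: t i \in enum_val i by rewrite -coset_repE rcoset_refl.
rewrite def_i => /rcosetP[h Hh ->]; by rewrite groupM // (fintype.subsetP sHG).
Qed.

Lemma coset_repP y :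
  y \in G -> exists j, forall i, (y * (t i)^-1 \in H)%g = (i == j).
Proof.
move=> Gy; have Hy: H :* y \in rcosets H G.
  by apply/rcosetsP; exists y.
exists (enum_rank_in Hy (H :* y)) => i.
rewrite -(inj_eq enum_val_inj) enum_rankK_in // -coset_repE eq_sym -mem_rcoset.
by apply/idP/eqP=> [/rcoset_eqP | <-]; rewrite ?rcoset_refl.
Qed.

Lemma coset_repV i j : (t i * (t j)^-1 \in H)%g = (i == j).
Proof.
have [j0 j0P] := coset_repP (coset_rep_in i).
have /eqP ij0: i == j0 by rewrite -j0P mulgV group1.
by rewrite j0P -ij0 eq_sym.
Qed.


Definition block_scalar a b (f : 'M[k]_(a, b)) :
    'M[k]_(\sum_(i < m) a, \sum_(i < m) b) :=
  \mxblock_(i < m, j < m) (if i == j then f else 0).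

Lemma block_scalar1 a : block_scalar (1%:M : 'M_a) = 1%:M.
Proof.
rewrite -(mxdiagZ (p_ := fun=> a) 1); apply: eq_mxblock => i j.
by rewrite conform_mx_id.
Qed.

Lemma block_scalarM a b c (f : 'M_(a, b)) (g : 'M_(b, c)) :
  block_scalar f *m block_scalar g = block_scalar (f *m g).
Proof.
rewrite /block_scalar mul_mxblock; apply: eq_mxblock => i j.
rewrite (bigD1 i) //= eqxx big1 ?addr0 => [|l /negPf li].
  by case: eqP => // _; rewrite mulmx0.
by rewrite eq_sym li mul0mx.
Qed.

Lemma block_scalar0 a b : block_scalar (0 : 'M_(a, b)) = 0.
Proof.
by rewrite -[RHS]mxblock0; apply: eq_mxblock => i j; rewrite if_same.
Qed.

Section IndRepr.

Variable V : representation k H.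
Local Notation n := (rdegree V).

Definition ind_mx (x : gT) : 'M[k]_(\sum_(i < m) n) :=
  \mxblock_(i < m, j < m)
    (if (t i * x * (t j)^-1)%g \in H then V (t i * x * (t j)^-1)%g else 0).

Lemma ind_mx_repr : mx_repr G ind_mx.
Proof.
split=> [|x y Gx Gy].
  rewrite -block_scalar1; apply: eq_mxblock => i j; rewrite mulg1 coset_repV.
  by case: eqP => // ->; rewrite mulgV repr_mx1.
rewrite /ind_mx mul_mxblock; apply: eq_mxblock => i l.
have [|j jP] := @coset_repP (t i * x)%g; first by rewrite groupM ?coset_rep_in.
rewrite (bigD1 j) //= jP eqxx big1 ?addr0 => [|j' /negPf j'j]; last first.
  by rewrite jP j'j mul0mx.
have Hj : (t i * x * (t j)^-1)%g \in H by rewrite jP.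
have -> : (t i * (x * y) * (t l)^-1)%g
        = ((t i * x * (t j)^-1) * (t j * y * (t l)^-1))%g.
  by rewrite !mulgA mulgKV.
rewrite groupMl //; case: ifP => [Hl|_]; last by rewrite mulmx0.
by rewrite repr_mxM.
Qed.

Definition ind_grepr : representation k G :=
  Representation (MxRepresentation ind_mx_repr).

End IndRepr.

Lemma ind_hom (U V : representation k H) (f : 'M_(rdegree U, rdegree V)) :
  grepr_hom f -> @grepr_hom _ _ _ (ind_grepr U) (ind_grepr V) (block_scalar f).
Proof.
move=> hf x Gx; rewrite /= /ind_mx /block_scalar !mul_mxblock.
apply: eq_mxblock => i l.
rewrite (bigD1 l) //= eqxx big1 ?addr0 => [|j /negPf ->]; last by rewrite mulmx0.
rewrite (bigD1 i) //= eqxx big1 ?addr0 => [|j /negPf ji]; last first.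
  by rewrite eq_sym ji mul0mx.
by case: ifP => [Hx|_]; rewrite ?mul0mx ?mulmx0 ?hf.
Qed.

Lemma block_scalar_free a b (f : 'M_(a, b)) :
  row_free f -> row_free (block_scalar f).
Proof.
case/row_freeP=> f' ff'; apply/row_freeP; exists (block_scalar f').
by rewrite block_scalarM ff' block_scalar1.
Qed.

Lemma block_scalar_full a b (f : 'M_(a, b)) :
  row_full f -> row_full (block_scalar f).
Proof.
case/row_fullP=> f' ff'; apply/row_fullP; exists (block_scalar f').
by rewrite block_scalarM ff' block_scalar1.
Qed.

Lemma ind_exact (U V W : representation k H) f g :
  @short_exact _ _ _ U V W f g ->
  @short_exact _ _ _ (ind_grepr U) (ind_grepr V) (ind_grepr W)
    (block_scalar f) (block_scalar g).
Proof.
case=> hf hg free_f full_g fg.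
have free_bf := block_scalar_free free_f.
have full_bg := block_scalar_full full_g.
split=> //; try exact: ind_hom.
have fg0 : f *m g = 0 by apply/sub_kermxP; case/andP: fg.
have rUVW : (rdegree U + rdegree W = rdegree V)%N.
  have: \rank f = \rank (kermx g) by rewrite (eqmxP fg).
  rewrite mxrank_ker.
  move: free_f full_g (rank_leq_row g); rewrite /row_free /row_full.
  by move=> /eqP-> /eqP-> le_WV ->; rewrite subnK.
have sub : (block_scalar f <= kermx (block_scalar g))%MS.
  by apply/sub_kermxP; rewrite block_scalarM fg0 block_scalar0.
rewrite -(mxrank_leqif_eq sub) mxrank_ker.
move: free_bf full_bg; rewrite /row_free /row_full => /eqP-> /eqP->.
by rewrite !sum_nat_const !card_ord -rUVW mulnDr addnK.
Qed.

Lemma ind_projective (P : representation k H) :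
  projective P -> projective (ind_grepr P).
Proof.
move=> /projectiveP lP; apply/projectiveP => B C g F hg full_g hF.
have sGH x : x \in H -> x \in G := fintype.subsetP sHG x.
pose r (X : representation k G) : representation k H :=
  Representation (subg_repr X sHG).
have FE i x y : x \in G -> forall j, y = (t i * x * (t j)^-1)%g -> y \in H ->
    (submxcol F i : 'M_(rdegree P, _)) *m C x
      = P y *m (submxcol F j : 'M_(rdegree P, _)).
  move=> Gx j -> Hy; have hFx := hF x Gx; move: hFx.
  rewrite /= /ind_mx -{1 2}[F]submxcolK mul_mxblock_mxrow mxcol_mul.
  move/eq_mxcolP/(_ i) <-; rewrite (bigD1 j) //= Hy big1 ?addr0 // => j' j'j.
  case: ifP => Hy'; last by rewrite mul0mx.
  case/negP: j'j; rewrite -coset_repV.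
  have -> : (t j' * (t j)^-1 = (t i * x * (t j')^-1)^-1 * (t i * x * (t j)^-1))%g.
    by rewrite !invMg !invgK -!mulgA !mulKg.
  by rewrite groupM ?groupV.
have [j0 j0P] := coset_repP (group1 G).
have Hj0 : t j0 \in H by rewrite -groupV -(mul1g (t j0)^-1%g) j0P.
pose h1 : 'M_(rdegree P, rdegree C) :=
  (submxcol F j0 : 'M_(rdegree P, _)) *m C ((t j0)^-1)%g.
have Gt i := coset_rep_in i.
have h1E : h1 = P ((t j0)^-1)%g *m (submxcol F j0 : 'M_(rdegree P, _)).
  by rewrite /h1 (FE _ _ ((t j0)^-1)%g _ j0) ?groupV // mulgV mul1g.
have hh1 : @grepr_hom _ _ _ P (r C) h1.
  move=> x Hx; have Gx := sGH x Hx.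
  have yE : (x * (t j0)^-1 = t j0 * ((t j0)^-1 * x) * (t j0)^-1)%g.
    by rewrite mulKVg.
  rewrite /= /h1 -mulmxA -repr_mxM ?groupV //.
  rewrite (FE _ _ _ _ _ yE) ?groupM ?groupV //.
  by rewrite repr_mxM ?groupV // -mulmxA -h1E.
have h1t j : h1 *m C (t j) = submxcol F j.
  rewrite /h1 -mulmxA -repr_mxM ?groupV //.
  rewrite (FE _ _ 1%g _ j) ?group1 ?groupM ?groupV //.
    by rewrite repr_mx1 mul1mx.
  by rewrite mulgA mulgV mul1g mulgV.
have [|||h' hh' h'g] := lP (r B) (r C) g h1 => //.
  by move=> x /sGH Gx; exact: hg.
exists (\mxcol_(i < m) (h' *m B (t i))); last first.
  rewrite mxcol_mul -[F]submxcolK; apply: eq_mxcol => i.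
  by rewrite -mulmxA hg // mulmxA h'g h1t.
move=> x Gx; rewrite /= /ind_mx mul_mxblock_mxrow mxcol_mul.
apply: eq_mxcol => i.
have [|j jP] := @coset_repP (t i * x)%g; first by rewrite groupM.
rewrite (bigD1 j) //= jP eqxx big1 ?addr0 => [|j' /negPf j'j]; last first.
  by rewrite jP j'j mul0mx.
have Hj : (t i * x * (t j)^-1)%g \in H by rewrite jP.
rewrite mulmxA hh' //= -!mulmxA -!repr_mxM ?groupM ?groupV //.
by rewrite mulgKV.
Qed.

Definition ind_Rk : Rk k H -> Rk k G :=
  groth_lift (fun V => Rk_class (ind_grepr V)).

Let ind_Rk_exact U V W f g : @short_exact _ _ H U V W f g ->
  Rk_class (ind_grepr V) = Rk_class (ind_grepr U) + Rk_class (ind_grepr W).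
Proof. by move/ind_exact; exact: (@groth_class_exact _ _ G _ id). Qed.

Fact ind_Rk_is_zmod_morphism : zmod_morphism ind_Rk.
Proof. exact: groth_lift_is_zmod_morphism ind_Rk_exact. Qed.
HB.instance Definition _ :=
  GRing.isZmodMorphism.Build (Rk k H) (Rk k G) ind_Rk ind_Rk_is_zmod_morphism.

Lemma ind_RkE V : ind_Rk (Rk_class V) = Rk_class (ind_grepr V).
Proof. exact: groth_liftE ind_Rk_exact V. Qed.

Definition ind_Sk : Sk k H -> Sk k G :=
  quotz_lift (Sk_proj (G := G) \o ind_Rk).

Let ind_Sk_kill (x : Rk k H) :
  range (@cartan k gT H) x -> (Sk_proj (G := G) \o ind_Rk) x = 0.
Proof.
case=> y _ <-; move: y; apply: groth_ind => [|y z|P].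
- by rewrite !raddf0.
- by move=> /= y0 z0; rewrite !raddfB /= y0 z0 subrr.
rewrite /= cartanE ind_RkE.
pose Q : projrep k G := exist _ _ (ind_projective (svalP P)).
rewrite -[Rk_class _](cartanE Q) -[RHS](raddf0 (@Sk_proj k gT G)).
by apply/quotz_pi_eq/zgen_gen; rewrite subr0; exists (groth_class _ Q).
Qed.

Fact ind_Sk_is_zmod_morphism : zmod_morphism ind_Sk.
Proof. exact: quotz_lift_is_zmod_morphism ind_Sk_kill. Qed.
HB.instance Definition _ :=
  GRing.isZmodMorphism.Build (Sk k H) (Sk k G) ind_Sk ind_Sk_is_zmod_morphism.

Lemma ind_SkE x : ind_Sk (Sk_proj x) = Sk_proj (ind_Rk x).
Proof. exact: quotz_lift_pi ind_Sk_kill x. Qed.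

End Induction.

Definition p_subgroups (p : nat) (gT : finGroupType) (G : {group gT}) :
    {set {group gT}} := [set H : {group gT} | (H \subset G) && p.-group H]%SET.

Lemma p_subgroups_sub p (gT : finGroupType) (G : {group gT})
    (H : {H : {group gT} | H \in p_subgroups p G}) : sval H \subset G.
Proof. by have := svalP H; rewrite inE => /andP[]. Qed.

(* As the family is finite, elements of the direct sum are all dependent
   functions on it.                                                         *)
Definition ind_sum (k : fieldType) (p : nat) (gT : finGroupType)
    (G : {group gT})
    (x : forall H : {H : {group gT} | H \in p_subgroups p G}, Sk k (sval H)) :
    Sk k G :=
  \sum_(H : {H : {group gT} | H \in p_subgroups p G})
     ind_Sk (p_subgroups_sub H) (x H).

(* Main.v *)
From Stdlib Require List.
From HB Require Import structures.
Require Import Defs.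
From mathcomp Require Import all_boot all_order all_algebra all_fingroup.
From mathcomp Require Import all_solvable all_field all_character.

Set Implicit Arguments.
Unset Strict Implicit.
Unset Printing Implicit Defensive.

Import GroupScope GRing.Theory.
Local Open Scope ring_scope.

(** Induction from p-subgroups over a p-isolated group G.

    Let J be the subgroup of R_k(G) generated by the modules induced from
    p-subgroups and by the projective modules; we need [V] in J for all V.

    If H is p-isolated and has a normal Sylow p-subgroup or a normal
    p-complement, then H = A ><| K with one factor a p-group and the other a
    p'-group, and K meets its other conjugates trivially.
    - If K <> 1 is the p-group, k[H/K] is the sum of k and a projective module,
      because H is free on pairs of distinct points of H/K and |H/K| = 1 mod p.
    - If A is the p-group, k[H/K] is projective and has the same composition
      factors as the permutation module on H/K where H acts through K, which is
      the sum of k and of modules induced from A.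
    Tensoring with V gives the claim for H.

    For general G, the virtual permutation characters of G-sets whose
    stabilisers are of this kind form a ring of integral functions on G. For
    each x in G and prime q it has a member whose value at x is prime to q, the
    character of G/H where H = <x_q'> Q and Q is a Sylow q-subgroup of the
    normaliser of <x_q'>. Hence the constant function 1 belongs to the ring: for
    two such G-sets T1, T2, the sets T1 and T2 + {pt} have the same permutation
    character. By Brauer-Nesbitt [F_p T1] = [F_p T2] + [F_p] in the Grothendieck
    group over F_p, and extending scalars and tensoring with V puts [V] in J. *)

(** * Classes of modules and projectivity *)

Section Classes.

Variables (k : fieldType) (gT : finGroupType) (G : {group gT}).
Local Notation kGmod := (representation k G).
Implicit Types U V W M : kGmod.

Lemma Rk_class_exact U V W (f : 'M_(rdegree U, rdegree V))
    (g : 'M_(rdegree V, rdegree W)) :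
  short_exact f g -> Rk_class V = Rk_class U + Rk_class W.
Proof. exact: (@groth_class_exact _ _ G _ id). Qed.

(** In degree 0 the zero maps [V -> V -> V] form a short exact sequence, so the class equals its own
    double. *)
Lemma Rk_class_deg0 V : rdegree V = 0%N -> Rk_class V = 0.
Proof.
move=> V0; suff: Rk_class V = Rk_class V + Rk_class V.
  by move/eqP; rewrite -[X in X == _]addr0 (inj_eq (addrI _)) eq_sym => /eqP.
apply: (@Rk_class_exact V V V 0 0).
have E m (A B : 'M[k]_(m, rdegree V)) : A = B.
  by apply/matrixP=> i j; case: (j) => i0 lt_i0; exfalso; move: lt_i0; rewrite V0.
split; try by move=> x _; apply: E.
- by rewrite /row_free mxrank0 V0.
- by rewrite /row_full mxrank0 V0.
by apply/andP; split; [rewrite sub0mx | rewrite (E _ (kermx _) 0) sub0mx].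
Qed.

Lemma Rk_class_iso U V (f : 'M_(rdegree U, rdegree V)) :
  grepr_hom f -> row_free f -> row_full f -> Rk_class U = Rk_class V.
Proof.
move=> hf f_free f_full.
rewrite (@Rk_class_exact U V grepr0 f 0) ?[Rk_class grepr0]Rk_class_deg0 ?addr0 //.
split=> //; first by move=> x _; rewrite mulmx0 mul0mx.
  by rewrite /row_full mxrank0.
apply/andP; split; first by apply/sub_kermxP; rewrite mulmx0.
exact: submx_full.
Qed.

Lemma Rk_class_iso_full U V (f : 'M_(rdegree U, rdegree V)) :
  grepr_hom f -> row_full f -> rdegree U = rdegree V ->
  Rk_class U = Rk_class V.
Proof.
move=> hf f_full dUV; apply: (Rk_class_iso hf) => //.
by move: f_full; rewrite /row_full /row_free => /eqP->; rewrite dUV.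
Qed.

(** Once the composite vanishes, exactness in the middle is a dimension count. *)
Lemma short_exactI U V W (f : 'M_(rdegree U, rdegree V))
    (g : 'M_(rdegree V, rdegree W)) :
  grepr_hom f -> grepr_hom g -> row_free f -> row_full g -> f *m g = 0 ->
  (rdegree U + rdegree W = rdegree V)%N -> short_exact f g.
Proof.
move=> hf hg f_free g_full fg0 dV; split=> //.
have sub : (f <= kermx g)%MS by apply/sub_kermxP.
rewrite -(mxrank_leqif_eq sub) mxrank_ker.
by move: f_free g_full; rewrite /row_free /row_full => /eqP-> /eqP->; rewrite -dV addnK.
Qed.

Lemma short_exact_mul0 U V W (f : 'M_(rdegree U, rdegree V))
    (g : 'M_(rdegree V, rdegree W)) : short_exact f g -> f *m g = 0.
Proof. by case=> _ _ _ _ /andP[/sub_kermxP]. Qed.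

Lemma short_exact_deg U V W (f : 'M_(rdegree U, rdegree V))
    (g : 'M_(rdegree V, rdegree W)) :
  short_exact f g -> (rdegree U + rdegree W = rdegree V)%N.
Proof.
case=> _ _ f_free g_full fg; have: \rank f = \rank (kermx g) by rewrite (eqmxP fg).
rewrite mxrank_ker; move: f_free g_full (rank_leq_row g).
by rewrite /row_free /row_full => /eqP-> /eqP-> le_WV ->; rewrite subnK.
Qed.

(* Higman's criterion for projectivity. *)
Definition higman V :=
  exists phi : 'M[k]_(rdegree V), \sum_(x in G) V (x^-1)%g *m phi *m V x = 1%:M.

Lemma sum_conj_repr V W (f : 'M_(rdegree V, rdegree W)) :
  grepr_hom (\sum_(x in G) V (x^-1)%g *m f *m W x).
Proof.
move=> y Gy; rewrite mulmx_sumr mulmx_suml.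
rewrite (reindex_inj (mulIg y)) /=; apply: eq_big => [x|x Gx].
  by rewrite groupMr.
have {Gx} Gx : x \in G by rewrite -(groupMr x Gy).
rewrite invMg !repr_mxM ?groupV // !mulmxA.
by rewrite -[V y *m _]repr_mxM ?groupV // mulgV repr_mx1 mul1mx.
Qed.

(** A section [s] of [g] gives a linear lift [h *m s]; averaging [phi *m h *m s] over [G] makes it
    equivariant, and the identity satisfied by [phi] makes the average a lift of [h]. *)
Lemma higman_projective V : higman V -> projective V.
Proof.
case=> phi phiE; apply/projectiveP => B C g h hg g_full hh.
have [s sg] := row_fullP g_full.
exists (\sum_(x in G) V (x^-1)%g *m (phi *m h *m s) *m B x).
  exact: sum_conj_repr.
rewrite mulmx_suml -[RHS]mul1mx -phiE mulmx_suml; apply: eq_bigr => x Gx.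
by rewrite -!mulmxA hg // (mulmxA s) sg mul1mx hh.
Qed.

(** Maschke's argument: the order of [G] is invertible in [k]. *)
Lemma higman_pchar' V p : p \in [pchar k] -> p^'.-group G -> higman V.
Proof.
move=> pk p'G; exists ((#|G|%:R)^-1)%:M.
rewrite (eq_bigr (fun=> ((#|G|%:R)^-1)%:M)) => [|x Gx].
  rewrite sumr_const -scaler_nat scale_scalar_mx divff //.
  by rewrite -(dvdn_pcharf pk) -p'natE ?(pcharf_prime pk).
by rewrite mul_mx_scalar -scalemxAl -repr_mxM ?groupV // mulVg repr_mx1 scalemx1.
Qed.

(** Only the projection [s *m f] of [M] onto [U] has to be a sum of conjugates, which allows [M] to
    be non-projective. The witness is [phi] compressed to [U]. *)
Lemma higman_summand U M (f : 'M_(rdegree U, rdegree M)) (s : 'M_(rdegree M, rdegree U))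
    (phi : 'M_(rdegree M)) :
  grepr_hom f -> grepr_hom s -> f *m s = 1%:M ->
  s *m f = \sum_(x in G) M (x^-1)%g *m phi *m M x -> higman U.
Proof.
move=> hf hs fs sf; exists (f *m phi *m s).
rewrite -[RHS]fs -[f in RHS]mul1mx -fs -!mulmxA (mulmxA s) sf.
rewrite mulmx_suml mulmx_sumr; apply: eq_bigr => x Gx.
by rewrite !mulmxA hf ?groupV // -!mulmxA hs.
Qed.

End Classes.

Section BlockColumns.

Variables (k : fieldType) (n p q : nat).
Implicit Type C : 'I_q -> 'M[k]_(p, n).

Lemma mxcol_sub C i : (C i <= \mxcol_i C i)%MS.
Proof.
apply/submxP; exists (\mxrow_j (if j == i then 1%:M else 0)).
rewrite mul_mxrow_mxcol (bigD1 i) //= eqxx mul1mx big1 ?addr0 // => j /negPf ->.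
by rewrite mul0mx.
Qed.

Lemma sub_mxcol C m (B : 'M_(m, n)) :
  (forall i, (C i <= B)%MS) -> (\mxcol_i C i <= B)%MS.
Proof.
move=> sCB; apply/submxP; exists (\mxcol_i (C i *m pinvmx B)).
by rewrite mxcol_mul; apply: eq_mxcol => i; rewrite mulmxKpV.
Qed.

End BlockColumns.

(** * Induced modules *)

Section InducedCriterion.

Variables (k : fieldType) (gT : finGroupType).

(** Generation is tested against an arbitrary row space [B] so that it applies directly to the image
    or the kernel of a linear map. *)
Definition generates (G : {group gT}) (W : representation k G) d (f : 'M_(d, rdegree W)) :=
  forall m (B : 'M_(m, rdegree W)),
    (forall x, x \in G -> (f *m W x <= B)%MS) -> row_full B.

(** By Frobenius reciprocity [f] extends to the induced module, with blocks [f *m W (t i)];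
    generation makes the extension surjective and the degrees make it bijective. *)
Lemma Rk_class_ind (H G : {group gT}) (sHG : H \subset G)
    (U : representation k H) (W : representation k G)
    (f : 'M_(rdegree U, rdegree W)) :
  {in H, forall x, U x *m f = f *m W x} -> generates f ->
  rdegree W = (#|G : H| * rdegree U)%N ->
  Rk_class (ind_grepr sHG U) = Rk_class W.
Proof.
move=> hf gen_f dW; have sGH := fintype.subsetP sHG.
pose t := @coset_rep gT H G; have Gt i : t i \in G := coset_rep_in sHG i.
pose F : 'M_(rdegree (ind_grepr sHG U), rdegree W) := \mxcol_i (f *m W (t i)).
apply: (@Rk_class_iso_full _ _ _ (ind_grepr sHG U) W F).
- move=> x Gx; rewrite /= /ind_mx mul_mxblock_mxrow mxcol_mul.
  apply: eq_mxcol => i.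
  have [|j jP] := @coset_repP _ H G (t i * x)%g; first by rewrite groupM.
  rewrite (bigD1 j) //= jP eqxx big1 ?addr0 => [|j' /negPf j'j]; last first.
    by rewrite jP j'j mul0mx.
  have Hj : (t i * x * (t j)^-1)%g \in H by rewrite jP.
  rewrite mulmxA hf //= -!mulmxA -!repr_mxM ?groupM ?groupV //.
  by rewrite mulgKV.
- apply: gen_f => x Gx; have [i iP] := @coset_repP _ H G x Gx.
  have Hi : (x * (t i)^-1)%g \in H by rewrite iP.
  rewrite -[x](mulgKV (t i)) repr_mxM ?groupM ?groupV // mulmxA -hf // -mulmxA.
  apply: submx_trans (submxMl _ _) _.
  exact: mxcol_sub (fun i => f *m W (t i)) i.
by rewrite dW /= sum_nat_const card_ord.
Qed.

Lemma ind_grepr_generated (H G : {group gT}) (sHG : H \subset G)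
    (U : representation k H) :
  exists f : 'M_(rdegree U, rdegree (ind_grepr sHG U)),
    {in H, forall x, U x *m f = f *m ind_grepr sHG U x} /\ generates f.
Proof.
pose t := @coset_rep gT H G; have Gt i : t i \in G := coset_rep_in sHG i.
have [j0 j0P] := @coset_repP _ H G _ (group1 G).
have Hj0 : t j0 \in H by rewrite -groupV -(mul1g (t j0)^-1%g) j0P.
(* [j0] indexes the coset [H] itself, and the chosen representative of a group is 1. *)
have tj0 : t j0 = 1%g.
  by rewrite /t /coset_rep -coset_repE -/t rcoset_id // repr_group.
pose f : 'M_(rdegree U, rdegree (ind_grepr sHG U)) :=
  \mxrow_j (if j == j0 then 1%:M else 0 : 'M[k]_(rdegree U)).
have fE x : f *m ind_grepr sHG U x =
    \mxrow_l (if (x * (t l)^-1)%g \in H then U (x * (t l)^-1)%g else 0).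
  rewrite /= /ind_mx mul_mxrow_mxblock; apply: eq_mxrow => l.
  rewrite (bigD1 j0) //= eqxx big1 ?addr0 => [|j /negPf ->]; last by rewrite mul0mx.
  by rewrite -/(t j0) tj0 mul1g mul1mx.
exists f; split=> [x Hx | m B sB].
  rewrite fE mul_mxrow; apply: eq_mxrow => l.
  rewrite groupMl // -[(t l)^-1%g]mul1g j0P eq_sym mul1g.
  case: eqP => [<-|_]; last by rewrite mulmx0.
  by rewrite -/(t j0) tj0 invg1 mulg1 mulmx1.
rewrite -sub1mx -(block_scalar1 k H G) /block_scalar mxblockEv; apply: sub_mxcol => i.
apply: submx_trans (sB _ (Gt i)); rewrite fE.
suff -> : \mxrow_l (if i == l then 1%:M else 0 : 'M[k]_(rdegree U))
  = \mxrow_l (if (t i * (t l)^-1)%g \in H then U (t i * (t l)^-1)%g else 0) by [].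
apply: eq_mxrow => l; rewrite coset_repV //.
by case: eqP => // ->; rewrite mulgV repr_mx1.
Qed.

Lemma Rk_class_ind_trans (K H G : {group gT}) (sKH : K \subset H)
    (sHG : H \subset G) (sKG : K \subset G) (U : representation k K) :
  Rk_class (ind_grepr sHG (ind_grepr sKH U)) = Rk_class (ind_grepr sKG U).
Proof.
have [f [hf gen_f]] := ind_grepr_generated sKH U.
have [g [hg gen_g]] := ind_grepr_generated sHG (ind_grepr sKH U).
apply/esym/(@Rk_class_ind _ _ sKG U _ (f *m g)) => [x Kx | m B sB |].
- by rewrite mulmxA hf // -mulmxA hg ?mulmxA // (fintype.subsetP sKH).
- apply: (gen_g) => x Gx; set W := ind_grepr sHG _ in B sB *.
  (* [N] consists of the vectors of the intermediate module that [g *m W x] sends into [B]; it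
     contains all translates of the rows of [f], so it is everything. *)
  pose N := kermx (g *m W x *m cokermx B).
  have /row_fullP[D DN]: row_full N.
    apply: (gen_f) => y Hy; apply/sub_kermxP.
    have Gy : y \in G by rewrite (fintype.subsetP sHG).
    have E (C : 'M_(rdegree W)) :
        f *m ind_grepr sKH U y *m (g *m W x *m C) = f *m g *m W (y * x)%g *m C.
      rewrite repr_mxM // -!mulmxA; congr (_ *m _).
      by rewrite mulmxA hg // -/W -!mulmxA.
    by apply/eqP; rewrite E -submxE sB ?groupM.
  by rewrite submxE -[_ *m cokermx B]mul1mx -DN -mulmxA mulmx_ker mulmx0.
by rewrite /= !sum_nat_const !card_ord mulnA Lagrange_index.
Qed.

End InducedCriterion.

(** * Tensor products *)

Section Tensor.

Variable k : fieldType.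

Definition kron m n a b (A : 'M[k]_(m, n)) (B : 'M[k]_(a, b)) :
    'M[k]_(\sum_(i < m) a, \sum_(j < n) b) :=
  \mxblock_(i < m, j < n) (A i j *: B).

Lemma kronM m n l a b c (A : 'M_(m, n)) (C : 'M_(n, l)) (B : 'M_(a, b)) (D : 'M_(b, c)) :
  kron A B *m kron C D = kron (A *m C) (B *m D).
Proof.
rewrite /kron mul_mxblock; apply: eq_mxblock => i j.
rewrite mxE scaler_suml; apply: eq_bigr => l' _.
by rewrite -scalemxAl -scalemxAr scalerA.
Qed.

Lemma kron1 m a : kron (1%:M : 'M_m) (1%:M : 'M_a) = 1%:M.
Proof.
rewrite -(mxdiagZ (p_ := fun=> a) 1); apply: eq_mxblock => i j.
by rewrite conform_mx_id mxE; case: eqP => _; rewrite ?scale1r ?scale0r.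
Qed.

Lemma kron0 m n a b (B : 'M_(a, b)) : kron (0 : 'M_(m, n)) B = 0.
Proof.
by rewrite -[RHS]mxblock0; apply: eq_mxblock => i j; rewrite mxE scale0r.
Qed.

Lemma kron_sum (I : Type) (r : seq I) (P : pred I) m n a b (A : I -> 'M_(m, n)) (B : 'M_(a, b)) :
  kron (\sum_(i <- r | P i) A i) B = \sum_(i <- r | P i) kron (A i) B.
Proof.
apply: (big_morph (fun A => kron A B)); last exact: kron0.
move=> C D; rewrite /kron -mxblockD; apply: eq_mxblock => i j.
by rewrite mxE scalerDl.
Qed.

Lemma kron_free m n a (A : 'M_(m, n)) : row_free A -> row_free (kron A (1%:M : 'M_a)).
Proof.
case/row_freeP=> B AB; apply/row_freeP; exists (kron B 1%:M).
by rewrite kronM AB mul1mx kron1.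
Qed.

Lemma kron_full m n a (A : 'M_(m, n)) : row_full A -> row_full (kron A (1%:M : 'M_a)).
Proof.
case/row_fullP=> B BA; apply/row_fullP; exists (kron B 1%:M).
by rewrite kronM BA mul1mx kron1.
Qed.

Variables (F : fieldType) (phi : {rmorphism F -> k}) (gT : finGroupType).

Section Twist.

Variables (G : {group gT}) (V : representation k G).

Lemma twist_mx_repr (U : representation F G) :
  mx_repr G (fun x => kron (map_mx phi (U x)) (V x)).
Proof.
split=> [|x y Gx Gy]; first by rewrite !repr_mx1 map_mx1 kron1.
by rewrite !repr_mxM // map_mxM kronM.
Qed.

(* Extension of scalars along [phi], followed by the tensor product with [V]. *)
Definition twist U : representation k G :=
  Representation (MxRepresentation (twist_mx_repr U)).

Lemma twist_exact (U1 U2 U3 : representation F G) (f : 'M_(rdegree U1, rdegree U2))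
    (g : 'M_(rdegree U2, rdegree U3)) :
  short_exact f g ->
  Rk_class (twist U2) = Rk_class (twist U1) + Rk_class (twist U3).
Proof.
move=> fg; have [hf hg f_free g_full _] := fg.
have hom (U W : representation F G) (h : 'M_(rdegree U, rdegree W)) : grepr_hom h ->
    @grepr_hom _ _ _ (twist U) (twist W) (kron (map_mx phi h) 1%:M).
  by move=> hh x Gx; rewrite /= !kronM mulmx1 mul1mx -!map_mxM hh.
apply: (@Rk_class_exact k gT G (twist U1) (twist U2) (twist U3)
          (kron (map_mx phi f) 1%:M) (kron (map_mx phi g) 1%:M)).
apply: short_exactI; first exact: (hom _ _ _ hf).
- exact: (hom _ _ _ hg).
- by rewrite kron_free // /row_free mxrank_map.
- by rewrite kron_full // /row_full mxrank_map.
- by rewrite kronM -map_mxM (short_exact_mul0 fg) map_mx0 kron0.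
by rewrite /= !sum_nat_const !card_ord -mulnDl (short_exact_deg fg).
Qed.

Definition twist_Rk : Rk F G -> Rk k G := groth_lift (fun U => Rk_class (twist U)).

Fact twist_Rk_is_zmod_morphism : zmod_morphism twist_Rk.
Proof. exact: groth_lift_is_zmod_morphism twist_exact. Qed.
HB.instance Definition _ :=
  GRing.isZmodMorphism.Build (Rk F G) (Rk k G) twist_Rk twist_Rk_is_zmod_morphism.

Lemma twist_RkE U : twist_Rk (Rk_class U) = Rk_class (twist U).
Proof. exact: groth_liftE twist_exact U. Qed.

(** With the identity as second tensor factor, conjugation by [V x] does nothing there, so the sum
    reduces to the one for [psi]. *)
Lemma higman_twist U : higman U -> higman (twist U).
Proof.
case=> psi psiE; exists (kron (map_mx phi psi) 1%:M).
have -> : 1%:M = kron (map_mx phi (\sum_(x in G) U (x^-1)%g *m psi *m U x)) 1%:M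
    :> 'M_(rdegree (twist U)) by rewrite psiE map_mx1 kron1.
rewrite raddf_sum kron_sum; apply: eq_bigr => x Gx.
rewrite /= !kronM -!map_mxM mulmx1 -repr_mxM ?groupV //.
by rewrite mulVg repr_mx1.
Qed.

End Twist.

End Tensor.

(** * Permutation modules *)

Section PermutationModules.

Variables (gT : finGroupType) (G : {group gT}) (T : finType) (to : action G T).

(** The ring of coefficients varies because the same matrices are used over the integers, the prime
    field and the algebraic numbers. *)
Definition actmx (R : nzRingType) (x : gT) : 'M[R]_#|T| :=
  \matrix_(i, j) (to (enum_val i) x == enum_val j)%:R.

Lemma map_actmx (R S : nzRingType) (f : {rmorphism R -> S}) x :
  map_mx f (actmx R x) = actmx S x.
Proof. by apply/matrixP=> i j; rewrite !mxE rmorph_nat. Qed.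

Lemma actmx1 R : actmx R 1 = 1%:M.
Proof.
by apply/matrixP=> i j; rewrite !mxE act1 (inj_eq enum_val_inj).
Qed.

Lemma actmxM R : {in G &, {morph actmx R : x y / (x * y)%g >-> x *m y}}.
Proof.
move=> x y Gx Gy; apply/matrixP=> i j; rewrite !mxE.
rewrite (bigD1 (enum_rank (to (enum_val i) x))) //= !mxE enum_rankK eqxx mul1r.
rewrite actMin // big1 ?addr0 // => l /negPf li.
by rewrite mxE -(inj_eq enum_rank_inj) enum_valK eq_sym li mul0r.
Qed.

Definition fixnum x := #|[set t | to t x == t]|.

Lemma mxtrace_actmx R x : \tr (actmx R x) = (fixnum x)%:R.
Proof.
rewrite /mxtrace /fixnum -sum1dep_card natr_sum (reindex _ (onW_bij _ (@enum_rank_bij T))) /=.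
rewrite [in RHS]big_mkcond; apply: eq_bigr => t _.
by rewrite mxE !enum_rankK; case: eqP.
Qed.

Lemma actmx_repr (F : fieldType) : mx_repr G (actmx F).
Proof. by split; [exact: actmx1 | exact: actmxM]. Qed.

Definition permrep F : representation F G :=
  Representation (MxRepresentation (actmx_repr F)).

(** This is the tensor identity: tensoring the permutation module on [G/L] with [V] amounts to
    inducing the restriction of [V] to [L]. The copy of [V] sitting at the point [o], embedded by
    [E o 1%:M], generates the module. *)
Lemma twist_transitive (F k : fieldType) (phi : {rmorphism F -> k})
    (V : representation k G) (o : T) (sLG : 'C_G[o | to] \subset G) :
  orbit to G o = [set: T] ->
  twist_Rk phi V (Rk_class (permrep F)) =
    Rk_class (ind_grepr sLG (Representation (subg_repr V sLG))).
Proof.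
move=> trT; rewrite twist_RkE; set W := twist _ _ _.
pose d := rdegree V; pose E t (A : 'M[k]_d) : 'M[k]_(d, rdegree W) :=
  \mxrow_(j < #|T|) ((t == enum_val j)%:R *: A).
have EM x : x \in G -> E o 1%:M *m W x = E (to o x) (V x).
  move=> Gx; rewrite /E /W /= /kron mul_mxrow_mxblock; apply: eq_mxrow => j.
  rewrite (bigD1 (enum_rank o)) //= big1 ?addr0 => [|l lo].
    by rewrite enum_rankK eqxx scale1r mul1mx !mxE enum_rankK rmorph_nat.
  rewrite -(inj_eq enum_val_inj) enum_rankK eq_sym in lo.
  by rewrite (negPf lo) scale0r mul0mx.
have EMl t A B : B *m E t A = E t (B *m A).
  by rewrite /E mul_mxrow; apply: eq_mxrow => j; rewrite scalemxAr.
apply/esym/(@Rk_class_ind k gT _ G sLG (Representation (subg_repr V sLG)) W (E o 1%:M)).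
- move=> x; rewrite !inE sub1set inE => /and3P[Gx _ /eqP xo].
  by rewrite EM // xo /= EMl mulmx1.
- move=> m B sB; rewrite -sub1mx -(kron1 _ #|T|) /kron mxblockEv.
  apply: sub_mxcol => i; have: enum_val i \in orbit to G o by rewrite trT inE.
  case/orbitP=> x Gx xo.
  have -> : \mxrow_j ((1%:M : 'M[k]_#|T|) i j *: 1%:M) = V (x^-1)%g *m (E o 1%:M *m W x).
    rewrite EM // EMl xo -repr_mxM ?groupV // mulVg repr_mx1 /E.
    by apply: eq_mxrow => j; rewrite mxE (inj_eq enum_val_inj).
  exact: submx_trans (submxMl _ _) (sB _ Gx).
by rewrite /= sum_nat_const card_ord -cardsT -trT card_orbit_in.
Qed.

Lemma twist_point (F k : fieldType) (phi : {rmorphism F -> k})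
    (V : representation k G) (o : T) :
  (forall t, t = o) -> twist_Rk phi V (Rk_class (permrep F)) = Rk_class V.
Proof.
move=> oT; have T1 : #|T| = 1%N by apply: (@eq_card1 _ o) => t; rewrite [t]oT !inE eqxx.
rewrite twist_RkE; set W := twist _ _ _.
pose f : 'M_(rdegree W, rdegree V) := \mxcol_(i < #|T|) (1%:M : 'M[k]_(rdegree V)).
apply: (@Rk_class_iso_full _ _ _ W V f).
- move=> x Gx; rewrite /f /W /= /kron mul_mxblock_mxrow mxcol_mul.
  apply: eq_mxcol => i; rewrite (bigD1 i) //= big1 => [|j /negP[]].
    rewrite !mxE addr0 mulmx1 mul1mx; case: eqP => [_|[]].
      by rewrite rmorph1 scale1r.
    by rewrite [LHS]oT [RHS]oT.
  by apply/eqP/enum_val_inj; rewrite [LHS]oT [RHS]oT.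
- rewrite -sub1mx /f.
  exact: (mxcol_sub (fun i : 'I_#|T| => 1%:M : 'M[k]_(rdegree V)) (enum_rank o)).
by rewrite /= sum_nat_const card_ord T1 mul1n.
Qed.

End PermutationModules.

(** [f] is the inclusion of [F[T1]], and [g] reads off the coordinates in [T2], so it kills the
    image of [i1]. The cardinalities ensure that [i1] and [i2] together exhaust [T]. *)
Lemma permrep_split (gT : finGroupType) (G : {group gT}) (F : fieldType)
    (T T1 T2 : finType) (to : action G T) (to1 : action G T1) (to2 : action G T2)
    (i1 : T1 -> T) (i2 : T2 -> T) :
    injective i1 -> injective i2 -> (forall t1 t2, i1 t1 != i2 t2) ->
    #|T| = (#|T1| + #|T2|)%N ->
    {in G, forall x t, i1 (to1 t x) = to (i1 t) x} ->
    {in G, forall x t, i2 (to2 t x) = to (i2 t) x} ->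
  Rk_class (permrep to F) = Rk_class (permrep to1 F) + Rk_class (permrep to2 F).
Proof.
move=> inj1 inj2 i12 cT hi1 hi2.
pose f : 'M[F]_(#|T1|, #|T|) := \matrix_(i, j) (i1 (enum_val i) == enum_val j)%:R.
pose g : 'M[F]_(#|T|, #|T2|) := \matrix_(i, j) (enum_val i == i2 (enum_val j))%:R.
apply: (@Rk_class_exact F gT G (permrep to1 F) (permrep to F) (permrep to2 F) f g).
have sumE (T' : finType) (a : T') (h : 'I_#|T'| -> F) :
    \sum_j (a == enum_val j)%:R * h j = h (enum_rank a).
  rewrite (bigD1 (enum_rank a)) //= enum_rankK eqxx mul1r big1 ?addr0 // => j ja.
  by rewrite -(inj_eq enum_rank_inj) enum_valK eq_sym (negPf ja) mul0r.
apply: short_exactI => //.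
- move=> x Gx; apply/matrixP=> i j; rewrite !mxE.
  under eq_bigr => l _ do rewrite mxE.
  rewrite sumE mxE enum_rankK; under eq_bigr => l _ do rewrite mxE.
  by rewrite sumE mxE enum_rankK hi1.
- move=> x Gx; apply/matrixP=> i j; rewrite !mxE.
  under eq_bigr => l _ do rewrite mxE.
  rewrite sumE mxE enum_rankK; under eq_bigr => l _ do rewrite !mxE mulrC.
  rewrite (bigD1 (enum_rank (to2 (enum_val j) (x^-1)%g))) //= big1 => [|l].
    rewrite enum_rankK actKVin // eqxx mul1r addr0 hi2 ?groupV //.
    by rewrite -(can2_eq (actKin to Gx) (actKVin to Gx)).
  rewrite -(inj_eq enum_val_inj) enum_rankK -(can2_eq (actKin to2 Gx) (actKVin to2 Gx)).
  by move/negPf->; rewrite mul0r.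
- apply/row_freeP; exists f^T; apply/matrixP=> i j; rewrite !mxE.
  under eq_bigr => l _ do rewrite !mxE.
  by rewrite sumE enum_rankK (inj_eq inj1) (inj_eq enum_val_inj) eq_sym.
- apply/row_fullP; exists g^T; apply/matrixP=> i j; rewrite !mxE.
  under eq_bigr => l _ do rewrite !mxE eq_sym.
  by rewrite sumE enum_rankK (inj_eq inj2) (inj_eq enum_val_inj).
apply/matrixP=> i j; rewrite !mxE; under eq_bigr => l _ do rewrite mxE.
by rewrite sumE mxE enum_rankK (negPf (i12 _ _)).
Qed.

Lemma astab1E (gT : finGroupType) (G : {group gT}) (T : finType) (to : action G T) t x :
  (x \in 'C_G[t | to]) = (x \in G) && (to t x == t).
Proof. by rewrite !inE; case: (x \in G); rewrite //= sub1set inE. Qed.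

Section MakeAction.

Variables (gT : finGroupType) (G : {group gT}) (T : finType) (f : T -> gT -> T).
Hypotheses (f1 : forall t, f t 1%g = t)
  (fM : {in G &, forall x y t, f t (x * y)%g = f (f t x) y}).

(* An [action] has to be injective for all elements of [gT], whereas [f] is only
   meaningful on [G]. *)
Definition guarded_act t x := if x \in G then f t x else t.

Fact guarded_act_is_action : is_action G guarded_act.
Proof.
split=> [x t u | t x y Gx Gy]; last by rewrite /guarded_act groupM // Gx Gy fM.
rewrite /guarded_act; case: ifP => // Gx /(congr1 (f^~ (x^-1)%g)).
by rewrite -!fM ?groupV // mulgV !f1.
Qed.

Definition mkact := Action guarded_act_is_action.

Lemma mkactE t : {in G, forall x, mkact t x = f t x}.
Proof. by move=> x Gx; rewrite /= /guarded_act Gx. Qed.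

End MakeAction.

Section RestrictedAction.

Variables (gT : finGroupType) (G : {group gT}) (T : finType) (to : action G T).
Variable S : {set T}.
Hypothesis GS : {in G, forall x, {in S, forall t, to t x \in S}}.
Local Notation TS := {t | t \in S}.

(** The default [u] of [insubd] can only be reached for [x] outside [G]. *)
Definition restrict_fun (u : TS) x : TS := insubd u (to (val u) x).

Lemma val_restrict_fun u : {in G, forall x, val (restrict_fun u x) = to (val u) x}.
Proof. by move=> x Gx; rewrite val_insubd GS // (valP u). Qed.

Fact restrict_fun1 u : restrict_fun u 1%g = u.
Proof. by apply: val_inj; rewrite val_restrict_fun // act1. Qed.

Fact restrict_funM :
  {in G &, forall x y u, restrict_fun u (x * y)%g = restrict_fun (restrict_fun u x) y}.
Proof.
move=> x y Gx Gy u; apply: val_inj.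
by rewrite !val_restrict_fun ?groupM // actMin.
Qed.

Definition restrict_act := mkact restrict_fun1 restrict_funM.

Lemma val_restrict_act u : {in G, forall x, val (restrict_act u x) = to (val u) x}.
Proof. by move=> x Gx; rewrite mkactE // val_restrict_fun. Qed.

Lemma astab1_restrict_act u : 'C_G[u | restrict_act] = 'C_G[val u | to].
Proof.
apply/setP=> x; rewrite !astab1E; case Gx: (x \in G) => //=.
by rewrite -(inj_eq val_inj) val_restrict_act.
Qed.

End RestrictedAction.

(** * The span of the induced and the projective classes *)

Section InductionSpan.

Variables (p : nat) (k : fieldType) (gT : finGroupType).
Implicit Types G H L : {group gT}.

Variant ind_gen G : Rk k G -> Prop :=
| IndGen (Q : {group gT}) (sQG : Q \subset G) (U : representation k Q) of p.-group Q :
    ind_gen (Rk_class (ind_grepr sQG U))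
| ProjGen (P : representation k G) of projective P : ind_gen (Rk_class P).

Definition ind_span G (y : Rk k G) := zgen (@ind_gen G) y.

Lemma ind_spanN G (y : Rk k G) : ind_span y -> ind_span (- y).
Proof. by rewrite -[- y]add0r; apply: zgenB; apply: zgen0. Qed.

Lemma ind_spanB G (y z : Rk k G) : ind_span y -> ind_span z -> ind_span (y - z).
Proof. exact: zgenB. Qed.

Lemma ind_spanD G (y z : Rk k G) : ind_span y -> ind_span z -> ind_span (y + z).
Proof. by move=> Jy Jz; rewrite -[z]opprK; apply/ind_spanB/ind_spanN. Qed.

Definition ind_good G L :=
  forall (sLG : L \subset G) U, ind_span (Rk_class (@ind_grepr k gT L G sLG U)).

Lemma ind_good_pgroup G L : p.-group L -> ind_good G L.
Proof. by move=> pL sLG U; apply/zgen_gen/IndGen. Qed.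

Lemma ind_good_projective G L :
  (forall U : representation k L, projective U) -> ind_good G L.
Proof. by move=> prL sLG U; apply/zgen_gen/ProjGen/ind_projective. Qed.

(** Induction is transitive and preserves projectives, so it maps the span for [L] into the span for
    [G]. *)
Lemma ind_good_span G L :
  (forall U : representation k L, ind_span (Rk_class U)) -> ind_good G L.
Proof.
move=> spL sLG U; rewrite -ind_RkE.
elim: (spL U) => [_ [Q sQL W pQ | P prP] | | y z _ Jy _ Jz].
- rewrite ind_RkE (Rk_class_ind_trans sQL sLG (subset_trans sQL sLG)).
  exact: ind_good_pgroup.
- by rewrite ind_RkE; apply/zgen_gen/ProjGen/ind_projective.
- by rewrite raddf0; apply: zgen0.
by rewrite raddfB; apply: ind_spanB.
Qed.

Variables (F : fieldType) (phi : {rmorphism F -> k}).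

(** Orbits are split off one at a time, by induction on the cardinality of [T]; on an orbit the
    tensor identity gives a class induced from a stabiliser. *)
Lemma ind_span_permrep G (T : finType) (to : action G T) (V : representation k G) :
  (forall t, ind_good G 'C_G[t | to]%G) ->
  ind_span (twist_Rk phi V (Rk_class (permrep to F))).
Proof.
have [n] := ubnP #|T|; elim: n T to => // n IHn T to leTn gT_to.
case: (pickP (predT : pred T)) => [o _ | T0]; last first.
  rewrite [Rk_class _]Rk_class_deg0 ?raddf0; first exact: zgen0.
  exact: eq_card0.
pose O := orbit to G o.
have stO : {in G, forall x, {in O, forall t, to t x \in O}}.
  move=> x Gx t /orbitP[y Gy <-]; rewrite -actMin //; exact/mem_orbit/groupM.
have stO' : {in G, forall x, {in ~: O, forall t, to t x \in ~: O}}.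
  move=> x Gx t; rewrite !inE; apply: contra => Otx.
  by rewrite -(actKin to Gx t); apply: stO; rewrite ?groupV.
pose toO := restrict_act stO; pose toO' := restrict_act stO'.
have cT : #|T| = (#|{: {t | t \in O}}| + #|{: {t | t \in ~: O}}|)%N.
  by rewrite !card_sig -(cardsC O); congr (_ + _)%N; apply: eq_card => t; rewrite !inE.
have Oo : o \in O by apply: orbit_refl.
rewrite (@permrep_split _ _ F _ _ _ to toO toO' val val) //; first last.
- by move=> x Gx t; apply: val_restrict_act.
- by move=> x Gx t; apply: val_restrict_act.
- move=> [t1 /= Ot1] [t2 /= O't2]; apply: contraTneq Ot1 => ->.
  by rewrite inE in O't2.
- exact: val_inj.
- exact: val_inj.
rewrite raddfD /=; apply: ind_spanD.
  pose u : {t | t \in O} := exist _ o Oo.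
  have sLG : 'C_G[u | toO] \subset G by apply: subsetIl.
  rewrite (@twist_transitive _ _ _ toO F k phi V u sLG).
    have := gT_to o; rewrite -[o]/(val u).
    have -> : 'C_G[val u | to]%G = 'C_G[u | toO]%G.
      by apply: val_inj; rewrite /= astab1_restrict_act.
    exact.
  apply/setP=> v; rewrite inE; have /orbitP[x Gx xv] := valP v.
  by apply/orbitP; exists x => //; apply: val_inj; rewrite val_restrict_act.
apply: IHn => [|v].
  rewrite cT ltnS in leTn; apply: leq_trans leTn.
  by rewrite -addn1 addnC leq_add2r card_sig; apply/card_gt0P; exists o.
have -> : 'C_G[v | toO']%G = 'C_G[val v | to]%G; last exact: gT_to.
by apply: val_inj; rewrite /= astab1_restrict_act.
Qed.

End InductionSpan.

(** * The Brauer-Nesbitt theorem *)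

(** In the basis formed by the rows of [f] and of a section [s] of [g], the matrix [A] becomes block
    triangular with diagonal blocks [B] and [C]; [D] holds the coordinates of [s *m A - C *m s]
    along [f]. *)
Lemma char_poly_extension (F : fieldType) n m1 m2 (A : 'M[F]_n) (B : 'M_m1)
    (C : 'M_m2) (f : 'M_(m1, n)) (g : 'M_(n, m2)) :
    row_free f -> row_full g -> f *m g = 0 -> (m1 + m2 = n)%N ->
    B *m f = f *m A -> A *m g = g *m C ->
  char_poly A = char_poly B * char_poly C.
Proof.
move=> f_free g_full fg0 dn; subst n => Bf Ag.
have [s sg] := row_fullP g_full.
have ker_g : (kermx g <= f)%MS.
  have sub : (f <= kermx g)%MS by apply/sub_kermxP.
  rewrite -(mxrank_leqif_sup sub) mxrank_ker.
  by move: f_free g_full; rewrite /row_free /row_full => /eqP-> /eqP->; rewrite addnK.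
have /submxP[D DE] : (s *m A - C *m s <= f)%MS.
  apply: submx_trans ker_g; apply/sub_kermxP.
  by rewrite mulmxBl -!mulmxA Ag (mulmxA s) sg mul1mx mulmx1 subrr.
pose T := col_mx f s; pose L := block_mx B 0 D C.
have TA : T *m A = L *m T.
  rewrite /T /L mul_col_mx mul_block_col mul0mx addr0 Bf -DE.
  by rewrite subrK.
have uT : T \in unitmx.
  rewrite -row_free_unit -kermx_eq0; apply/eqP; set K := kermx T.
  have : K *m T = 0 by apply: mulmx_ker.
  rewrite -[K]hsubmxK /T mul_row_col => KT.
  have R0 : rsubmx K = 0.
    have /(congr1 (mulmx^~ g)) := KT.
    by rewrite mulmxDl -!mulmxA fg0 sg mulmx0 mulmx1 add0r mul0mx.
  rewrite R0 mul0mx addr0 in KT *.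
  suff -> : lsubmx K = 0 by rewrite row_mx0.
  by apply: (row_free_inj f_free); rewrite KT mul0mx.
have -> : char_poly A = char_poly L.
  have AE : A = invmx T *m L *m T by rewrite -mulmxA -TA mulKmx.
  rewrite AE /char_poly /char_poly_mx.
  rewrite !map_mxM map_invmx.
  set T' := map_mx _ T; have uT' : T' \in unitmx by rewrite map_unitmx.
  have -> : 'X%:M - invmx T' *m map_mx polyC L *m T' =
    invmx T' *m ('X%:M - map_mx polyC L) *m T'.
    rewrite mulmxBr mulmxBl; congr (_ - _).
    by rewrite mul_mx_scalar -scalemxAl mulVmx // scalemx1.
  rewrite !det_mulmx mulrC mulrA -det_mulmx mulmxV // det1 mul1r //.
rewrite /char_poly /char_poly_mx /L map_block_mx scalar_mx_block opp_block_mx add_block_mx.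
by rewrite map_mx0 subrr det_lblock.
Qed.

Section BrauerNesbitt.

Variables (F : fieldType) (gT : finGroupType) (G : {group gT}).
Local Notation FGmod := (representation F G).
Local Notation aG := (Representation (regular_repr F G)).
Implicit Types U V W S T : FGmod.

Definition gring_act V (a : 'rV[F]_#|G|) : 'M[F]_(rdegree V) :=
  \sum_i a 0 i *: V (enum_val i).

Lemma mul_gring_act V (v : 'rV_(rdegree V)) a : v *m gring_act V a = a *m orbit_mx v.
Proof.
rewrite (mulmx_sum_row a) /gring_act mulmx_sumr; apply: eq_bigr => i _.
by rewrite rowK scalemxAr.
Qed.

Lemma gring_act_hom V W (f : 'M_(rdegree V, rdegree W)) a :
  grepr_hom f -> gring_act V a *m f = f *m gring_act W a.
Proof.
move=> hf; rewrite /gring_act mulmx_suml mulmx_sumr; apply: eq_bigr => i _.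
by rewrite -scalemxAl hf ?enum_valP // scalemxAr.
Qed.

Lemma char_poly_exact U V W (f : 'M_(rdegree U, rdegree V))
    (g : 'M_(rdegree V, rdegree W)) a :
  short_exact f g ->
  char_poly (gring_act V a) = char_poly (gring_act U a) * char_poly (gring_act W a).
Proof.
move=> fg; have [hf hg f_free g_full _] := fg.
apply: (char_poly_extension f_free g_full (short_exact_mul0 fg) (short_exact_deg fg)).
  exact: gring_act_hom.
exact: gring_act_hom.
Qed.

Lemma exact_iso U V (f : 'M_(rdegree U, rdegree V)) :
  grepr_hom f -> row_free f -> row_full f ->
  @short_exact _ _ G U V grepr0 f 0.
Proof.
move=> hf f_free f_full; apply: short_exactI => //=.
- by move=> x _; rewrite mulmx0 mul0mx.
- by rewrite /row_full mxrank0.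
- by rewrite mulmx0.
by move: f_free f_full; rewrite /row_free /row_full addn0 => /eqP-> /eqP.
Qed.

Definition grepr_iso U V :=
  exists2 f : 'M_(rdegree U, rdegree V), grepr_hom f & row_free f && row_full f.

Lemma char_poly_iso U V a : grepr_iso U V -> char_poly (gring_act U a) = char_poly (gring_act V a).
Proof.
case=> f hf /andP[f_free f_full].
rewrite (char_poly_exact a (exact_iso hf f_free f_full)).
by rewrite [X in _ * X]det_mx00 mulr1.
Qed.

Lemma Schur_iso S T (f : 'M_(rdegree T, rdegree S)) :
    mx_irreducible S -> mx_irreducible T -> grepr_hom f -> f != 0 -> grepr_iso T S.
Proof.
move=> /mx_irrP[_ irrS] /mx_irrP[_ irrT] hf f0; exists f => //; apply/andP; split.
  apply/negPn/negP; rewrite -kermx_eq0 => ker0.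
  have /irrT/(_ ker0)/row_fullP[B BK] : mxmodule T (kermx f).
    apply/mxmoduleP=> x Gx; apply/sub_kermxP.
    by rewrite -mulmxA hf // mulmxA mulmx_ker mul0mx.
  by case/eqP: f0; rewrite -[f]mul1mx -BK -mulmxA mulmx_ker mulmx0.
have /irrS : mxmodule S <<f>>%MS.
  rewrite (eqmx_module _ (genmxE f)); apply/mxmoduleP=> x Gx.
  by rewrite -hf // submxMl.
rewrite -mxrank_eq0 mxrank_gen mxrank_eq0 => /(_ f0).
by rewrite /row_full mxrank_gen.
Qed.

Lemma annihilator_step S T (v : 'rV_(rdegree S)) (w : 'rV_(rdegree T)) (K : 'M[F]_#|G|) :
    mx_irreducible S -> mx_irreducible T -> ~ grepr_iso T S -> mxmodule aG K ->
    K *m orbit_mx v != 0 ->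
  (K :&: kermx (orbit_mx w))%MS *m orbit_mx v != 0.
Proof.
move=> irrS irrT nST modK Kv; apply/negP=> /eqP Kwv; apply: nST.
(* On the right ideal [K] the map [a |-> v a] kills the kernel of [a |-> w a],
   so [w a |-> v a] is a well defined nonzero homomorphism from [T] to [S]. *)
set A := orbit_mx w in Kwv *; set B := orbit_mx v in Kv Kwv *.
have hA : @grepr_hom _ _ _ aG T A := orbit_mx_hom w.
have hB : @grepr_hom _ _ _ aG S B := orbit_mx_hom v.
have KA_B m (a : 'M_(m, #|G|)) : (a <= K)%MS -> a *m A = 0 -> a *m B = 0.
  move=> aK aA; have /submxP[D ->] : (a <= K :&: kermx A)%MS.
    by rewrite sub_capmx aK; apply/sub_kermxP.
  by rewrite -mulmxA Kwv mulmx0.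
have KA0 : K *m A != 0 by apply: contraNneq Kv => /KA_B->.
have /row_fullP[D DKA] : row_full (K *m A).
  have [_ irr] := iffLR (mx_irrP T) irrT.
  have /irr : mxmodule T <<K *m A>>%MS.
    rewrite (eqmx_module _ (genmxE _)); apply/mxmoduleP=> x Gx.
    by rewrite -mulmxA -hA // mulmxA submxMr // (mxmoduleP modK).
  by rewrite -mxrank_eq0 mxrank_gen mxrank_eq0 /row_full mxrank_gen; apply.
pose h := D *m K *m B.
have hE m (a : 'M_(m, #|G|)) : (a <= K)%MS -> a *m A *m h = a *m B.
  move=> aK; apply/eqP; rewrite -subr_eq0; apply/eqP.
  rewrite /h !mulmxA -mulmxBl; apply: KA_B.
    rewrite addmx_sub // ?eqmx_opp //; apply: mulmx_sub => //.
  by rewrite mulmxBl -!mulmxA DKA mulmx1 subrr.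
apply: (@Schur_iso S T h) => // [x Gx|].
  rewrite -[LHS]mul1mx -[RHS]mul1mx -DKA -!(mulmxA D); congr (_ *m _).
  rewrite [RHS]mulmxA hE // [LHS]mulmxA -(mulmxA K A) -hA // (mulmxA K).
  by rewrite hE ?(mxmoduleP modK) // -!mulmxA hB.
by apply: contraNneq Kv => h0; rewrite -(hE _ K) // h0 mulmx0.
Qed.

(** Cutting [K] down by the annihilator of one vector at a time keeps it a right ideal that does not
    kill [v]. *)
Lemma annihilator_seq S T (v : 'rV_(rdegree S)) (ws : seq 'rV_(rdegree T)) (K : 'M[F]_#|G|) :
    mx_irreducible S -> mx_irreducible T -> ~ grepr_iso T S -> mxmodule aG K ->
    K *m orbit_mx v != 0 ->
  exists K' : 'M_#|G|, [/\ mxmodule aG K', (K' <= K)%MS, K' *m orbit_mx v != 0 &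
    {in ws, forall w, K' *m orbit_mx w = 0}].
Proof.
move=> irrS irrT nST modK Kv; elim: ws => [|w ws [K' [modK' sK'K K'v K'ws]]].
  by exists K; split.
exists (K' :&: kermx (orbit_mx w))%MS; split.
- rewrite capmx_module //; apply/mxmoduleP=> x Gx; apply/sub_kermxP.
  rewrite -mulmxA [_ *m orbit_mx w](orbit_mx_hom w) //.
  by rewrite mulmxA mulmx_ker mul0mx.
- exact: submx_trans (capmxSl _ _) sK'K.
- exact: annihilator_step.
move=> u; rewrite inE => /predU1P[->|/K'ws K'u].
  by apply/sub_kermxP; apply: capmxSr.
have /submxP[D ->] := capmxSl K' (kermx (orbit_mx w)).
by rewrite -mulmxA K'u mulmx0.
Qed.

Lemma separating_element S (s : seq FGmod) :
    mx_irreducible S ->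
    List.Forall (fun T : FGmod => mx_irreducible T /\ ~ grepr_iso T S) s ->
  exists a, root (char_poly (gring_act S a)) 1 /\ List.Forall (fun T => gring_act T a = 0) s.
Proof.
move=> irrS; have [S_gt0 irr] := iffLR (mx_irrP S) irrS.
pose v : 'rV[F]_(rdegree S) := delta_mx 0 (Ordinal S_gt0).
have v0 : v != 0.
  apply/eqP=> /matrixP/(_ 0 (Ordinal S_gt0)).
  by rewrite !mxE !eqxx => /eqP; rewrite oner_eq0.
move=> irr_s.
suff [K [modK Kv Ks]] : exists K : 'M_#|G|, [/\ mxmodule aG K, K *m orbit_mx v != 0 &
    List.Forall (fun T => forall w : 'rV_(rdegree T), K *m orbit_mx w = 0) s].
  have /(submx_full v)/submxP[D vE] : row_full (K *m orbit_mx v).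
    have /irr : mxmodule S <<K *m orbit_mx v>>%MS.
      rewrite (eqmx_module _ (genmxE _)); apply/mxmoduleP=> x Gx.
      by rewrite -mulmxA -(orbit_mx_hom v Gx) mulmxA submxMr // (mxmoduleP modK).
    by rewrite -mxrank_eq0 mxrank_gen mxrank_eq0 /row_full mxrank_gen; apply.
  exists (D *m K); split.
    rewrite -eigenvalue_root_char; apply/eigenvalueP; exists v => //.
    by rewrite mul_gring_act -mulmxA -vE scale1r.
  apply: List.Forall_impl Ks => T KT; apply/row_matrixP=> i.
  by rewrite rowE mul_gring_act -mulmxA KT mulmx0 row0.
elim: s irr_s => [_|T s IHs irr_Ts].
  exists 1%:M; split=> //; first exact: mxmodule1.
  rewrite mul1mx; apply: contraNneq v0 => ov.
  by have := orbit_mx_sub v; rewrite ov => /submx0null->.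
have [[irrT nTS] irr_s] := (List.Forall_inv irr_Ts, List.Forall_inv_tail irr_Ts).
have [K [modK Kv Ks]] := IHs irr_s.
(* To act as zero on [T] it is enough for [K'] to kill the vectors of a basis. *)
have [K' [modK' sK'K K'v K'T]] :=
  annihilator_seq [seq row i (1%:M : 'M_(rdegree T)) | i <- enum 'I_(rdegree T)]
    irrS irrT nTS modK Kv.
exists K'; split=> //; apply: List.Forall_cons => [w|].
  apply/row_matrixP=> i; rewrite row_mul -mul_gring_act row0.
  have -> : gring_act T (row i K') = 0; last by rewrite mulmx0.
  apply/row_matrixP=> j; rewrite rowE -row1 mul_gring_act -row_mul K'T ?row0 //.
  by apply: map_f; rewrite mem_enum.
apply: List.Forall_impl Ks => U KU w; have /submxP[D ->] := sK'K.
by rewrite -mulmxA KU mulmx0.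
Qed.

(** A single list carries the class and all the characteristic polynomials, so that the latter can
    be used to determine the former. *)
Lemma composition_factors V : exists s : seq FGmod,
  [/\ List.Forall (fun S : FGmod => mx_irreducible S) s,
      Rk_class V = \sum_(S <- s) Rk_class S &
      forall a, char_poly (gring_act V a) = \prod_(S <- s) char_poly (gring_act S a)].
Proof.
have [n] := ubnP (rdegree V); elim: n V => // n IHn V leVn.
have [V0 | Vgt0] := posnP (rdegree V).
  exists [::]; split; rewrite ?big_nil ?Rk_class_deg0 // => a.
  by rewrite big_nil; case: (rdegree V) V0 (gring_act V a) => // _ A; exact: det_mx00.
have [irrV | redV] := boolp.pselect (mx_irreducible V).
  by exists [:: V]; split=> [||a]; rewrite ?big_seq1 //; constructor.
have [U [modU U0 nfullU]] : exists U : 'M_(rdegree V), [/\ mxmodule V U, U != 0 & ~~ row_full U].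
  apply: boolp.contrapT => nU; apply: redV; apply/mx_irrP; split=> // U modU U0.
  by apply/negPn/negP => nf; apply: nU; exists U.
pose V1 : FGmod := Representation (submod_repr modU).
pose V2 : FGmod := Representation (factmod_repr modU).
pose f : 'M_(rdegree V1, rdegree V) := val_submod 1%:M.
pose g : 'M_(rdegree V, rdegree V2) := in_factmod U 1%:M.
have rU : (\rank U < rdegree V)%N by rewrite ltn_neqAle rank_leq_col andbT.
have fg : short_exact f g.
  apply: short_exactI.
  - by move=> x Gx; rewrite /f /= -val_submodE -[submod_mx _ _]mul1mx val_submodJ.
  - by move=> x Gx; rewrite /g /= -in_factmodJ // mul1mx [RHS]in_factmodE.
  - by rewrite /row_free /f val_submod1.
  - apply/row_fullP; exists (val_factmod 1%:M); rewrite -in_factmodE.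
    exact: val_factmodK.
  - by rewrite /g -in_factmodE; apply/eqP; rewrite in_factmod_eq0 val_submodP.
  by rewrite /= mxrank_coker subnKC // ltnW.
have [|s1 [irr1 cl1 cp1]] := IHn V1; first by apply: leq_trans rU _.
have [|s2 [irr2 cl2 cp2]] := IHn V2.
  apply: leq_trans (_ : rdegree V <= n)%N => //.
  by rewrite /= mxrank_coker ltn_subrL lt0n mxrank_eq0 U0.
exists (s1 ++ s2); split.
- exact/List.Forall_app.
- by rewrite (Rk_class_exact fg) big_cat cl1 cl2.
by move=> a; rewrite (char_poly_exact a fg) big_cat cp1 cp2.
Qed.

Lemma char_poly_gring_act0 V : char_poly (gring_act V 0) = 'X^(rdegree V).
Proof.
have -> : gring_act V 0 = 0 by apply: big1 => i _; rewrite mxE scale0r.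
by rewrite /char_poly /char_poly_mx map_mx0 subr0 det_scalar.
Qed.

(** The head [S] occurs in [s2] up to isomorphism and is cancelled on both sides. Otherwise a
    separating element would make the left product vanish at 1, while every factor on the right is a
    power of ['X]. *)
Lemma eq_composition_factors (s1 s2 : seq FGmod) :
    List.Forall (fun S : FGmod => mx_irreducible S) s1 ->
    List.Forall (fun S : FGmod => mx_irreducible S) s2 ->
    (forall a, \prod_(S <- s1) char_poly (gring_act S a) =
               \prod_(S <- s2) char_poly (gring_act S a)) ->
  \sum_(S <- s1) Rk_class S = \sum_(S <- s2) Rk_class S.
Proof.
elim: s1 s2 => [|S s1 IHs] s2 irr1 irr2 cp12.
  case: s2 irr2 cp12 => [|T s2] irr2 cp12; first by rewrite !big_nil.
  have [/mx_irrP[T_gt0 _] _] := (List.Forall_inv irr2, List.Forall_inv_tail irr2).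
  (* At the element 0 of the group algebra, the factor of [T] is ['X] to a positive power and
     vanishes at 0, unlike the empty product. *)
  have /(congr1 (fun q : {poly F} => q.[0])) := cp12 0.
  rewrite big_nil big_cons char_poly_gring_act0 hornerM hornerXn hornerC expr0n.
  by rewrite (gtn_eqF T_gt0) mul0r => /eqP; rewrite oner_eq0.
have [irrS {}irr1] := (List.Forall_inv irr1, List.Forall_inv_tail irr1).
have [[T [Ts2 isoTS]] | noT] := boolp.pselect (exists T, List.In T s2 /\ grepr_iso T S).
  have [l1 [l2 s2E]] := List.in_split T s2 Ts2.
  have {Ts2} s2E : s2 = l1 ++ T :: l2 by [].
  rewrite s2E in irr2 cp12 *.
  have [irrl1 irrTl2] := iffLR (List.Forall_app _ _ _) irr2.
  have irrl2 := List.Forall_inv_tail irrTl2.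
  have [h hh /andP[h_free h_full]] := isoTS.
  rewrite big_cons (IHs (l1 ++ l2)) //.
  - by rewrite !big_cat big_cons /= (Rk_class_iso hh h_free h_full) addrCA.
  - exact/List.Forall_app.
  move=> a; have := cp12 a; rewrite !big_cat !big_cons /= -(char_poly_iso a isoTS) mulrCA.
  by apply: mulfI; rewrite monic_neq0 // char_poly_monic.
have [|a [Sa s2a]] := @separating_element S s2 irrS.
  elim: (s2) irr2 noT => [|T s IH] irrs noT; first exact: List.Forall_nil.
  apply: List.Forall_cons.
    by split; [exact: List.Forall_inv irrs | move=> TS; apply: noT; exists T; split; [left|]].
  apply: IH (List.Forall_inv_tail irrs) _ => -[U [sU US]].
  by apply: noT; exists U; split=> //; right.
have /(congr1 (fun q : {poly F} => q.[1])) := cp12 a.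
rewrite big_cons hornerM (rootP Sa) mul0r => /esym/eqP; case/idPn.
elim: (s2) s2a => [|T s IH] sa; first by rewrite big_nil hornerC oner_eq0.
rewrite big_cons hornerM mulf_neq0 ?(IH (List.Forall_inv_tail sa)) //.
rewrite /char_poly /char_poly_mx (List.Forall_inv sa) map_mx0 subr0 det_scalar.
by rewrite hornerXn expr1n oner_eq0.
Qed.

Lemma Brauer_Nesbitt V W :
  (forall a, char_poly (gring_act V a) = char_poly (gring_act W a)) -> Rk_class V = Rk_class W.
Proof.
move=> cpVW; have [s1 [irr1 -> cp1]] := composition_factors V.
have [s2 [irr2 -> cp2]] := composition_factors W.
by apply: eq_composition_factors => // a; rewrite -cp1 -cp2.
Qed.

End BrauerNesbitt.

(** * Permutation modules with equal fixed-point counts *)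

Section FixedPointCounts.

Variables (gT : finGroupType) (G : {group gT}).
Variables (T1 T2 : finType) (to1 : action G T1) (to2 : action G T2).
Hypothesis eq_fix : {in G, forall x, fixnum to1 x = fixnum to2 x}.

Lemma permrep_similar : mx_rsim (permrep to1 algC) (permrep to2 algC).
Proof.
apply/cfRepr_rsimP/eqP/cfunP=> x; rewrite !cfunE.
by case Gx: (x \in G); rewrite ?mulr0n //= !mxtrace_actmx eq_fix.
Qed.

(* The permutation modules need not be isomorphic over 'F_p, so characteristic
   polynomials are compared over the integers, which embed in [algC]. *)
Lemma char_poly_actmx_int (b : 'I_#|G| -> int) :
  char_poly (\sum_i b i *: actmx to1 int (enum_val i)) =
  char_poly (\sum_i b i *: actmx to2 int (enum_val i)).
Proof.
pose f : {rmorphism int -> algC} := intr.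
apply: (@map_inj_poly _ _ f); [exact: intr_inj | exact: rmorph0 |].
rewrite !(map_char_poly f) !raddf_sum /=.
under eq_bigr => i _ do rewrite map_mxZ map_actmx.
under [in RHS]eq_bigr => i _ do rewrite map_mxZ map_actmx.
have [B n12 B_free hB] := permrep_similar.
(* Invariance under similarity is the case of a zero-dimensional quotient in
   [char_poly_extension]. *)
rewrite -[LHS]mulr1; have <- : char_poly (0 : 'M[algC]_0) = 1 by apply: det_mx00.
apply/esym; apply: (@char_poly_extension _ _ _ 0 _ _ 0 B (0 : 'M_(_, 0))) => //.
- by rewrite /row_full mxrank0.
- by rewrite mulmx0.
- by rewrite addn0.
- rewrite mulmx_suml mulmx_sumr; apply: eq_bigr => i _.
  by rewrite -scalemxAl -scalemxAr; congr (_ *: _); exact: hB (enum_valP i).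
by apply/matrixP=> i [].
Qed.

Lemma Rk_class_permrep_eq (p : nat) :
  Rk_class (permrep to1 'F_p) = Rk_class (permrep to2 'F_p).
Proof.
(* The coefficients of [a] are lifted to integers, so both characteristic polynomials are reductions
   of integral ones. *)
apply: Brauer_Nesbitt => a; pose b i : int := (a 0 i : nat)%:Z.
have gE (T : finType) (to : action G T) :
    gring_act (permrep to 'F_p) a = map_mx intr (\sum_i b i *: actmx to int (enum_val i)).
  rewrite raddf_sum; apply: eq_bigr => i _.
  by rewrite /= map_mxZ map_actmx /b /= -pmulrn natr_Zp.
by rewrite !gE -!map_char_poly char_poly_actmx_int.
Qed.

End FixedPointCounts.

(** * Inflation along the quotient by a normal p-subgroup *)

Section Twisted.

Variables (p : nat) (F : fieldType) (gT : finGroupType) (G N K : {group gT}).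
Hypotheses (charF : p \in [pchar F]) (pN : p.-group N) (defG : N ><| K = G).

Let sKG : K \subset G. Proof. by case/sdprodP: defG => _ <- _ _; apply: mulG_subr. Qed.
Let nsNG : N <| G. Proof. by case/sdprod_context: defG. Qed.
Let compK : K \in [complements to N in G].
Proof. by case/sdprod_context: defG => _ _ NK _ tiNK; apply/complP. Qed.

Local Notation pi := (remgr N K).

Let pi_in x : x \in G -> pi x \in K.
Proof. by case/sdprodP: defG => _ <- _ _; apply: mem_remgr. Qed.
Let piM : {in G &, {morph pi : x y / x * y}%g}. Proof. exact: remgrM. Qed.

(* [pi] is the projection of [G] onto [K] with kernel [N], so that
   [remgr_grepr V] is the inflation along [G / N = K] of [V] restricted to [K].
   It has the class of [V] because [N] acts trivially on simple modules. *)
Lemma remgr_repr_proof n (rG : mx_representation F G n) : mx_repr G (fun x => rG (pi x)).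
Proof.
split=> [|x y Gx Gy]; first by rewrite -(repr_mx1 rG) remgr1.
by rewrite piM // repr_mxM ?(fintype.subsetP sKG) ?pi_in.
Qed.
Definition remgr_grepr (V : representation F G) :=
  Representation (MxRepresentation (remgr_repr_proof V)).

Lemma remgr_exact U W Z (f : 'M_(rdegree U, rdegree W)) (g : 'M_(rdegree W, rdegree Z)) :
  @short_exact _ _ G U W Z f g ->
  Rk_class (remgr_grepr W) = Rk_class (remgr_grepr U) + Rk_class (remgr_grepr Z).
Proof.
case=> hf hg ? ? ?.
apply: (@Rk_class_exact _ _ G (remgr_grepr U) (remgr_grepr W) (remgr_grepr Z) f g).
by split=> // x /pi_in Kx /=; [apply: hf | apply: hg]; apply: (fintype.subsetP sKG).
Qed.

Definition remgr_Rk : Rk F G -> Rk F G :=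
  groth_lift (fun V => Rk_class (remgr_grepr V)).

Fact remgr_Rk_is_zmod_morphism : zmod_morphism remgr_Rk.
Proof. exact: groth_lift_is_zmod_morphism remgr_exact. Qed.
HB.instance Definition _ :=
  GRing.isZmodMorphism.Build (Rk F G) (Rk F G) remgr_Rk remgr_Rk_is_zmod_morphism.

Lemma remgr_RkE V : remgr_Rk (Rk_class V) = Rk_class (remgr_grepr V).
Proof. exact: groth_liftE remgr_exact V. Qed.

Lemma Rk_class_remgr V : Rk_class (remgr_grepr V) = Rk_class V.
Proof.
rewrite -remgr_RkE; have [s [irr_s -> _]] := composition_factors V.
rewrite raddf_sum; elim: s irr_s => [|S s IHs] irr_s; first by rewrite !big_nil.
rewrite !big_cons IHs; last exact: List.Forall_inv_tail irr_s.
congr (_ + _).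
have [S_gt0 irrS] := iffLR (mx_irrP S) (List.Forall_inv irr_s).
have sNG : N \subset G by case/andP: nsNG.
(* In characteristic [p] the p-group [N] has nonzero fixed vectors; as [N] is normal they form a
   submodule, which is all of the simple module [S]. *)
have /irrS/(_ (rfix_pgroup_pchar charF S S_gt0 pN sNG)) : mxmodule S (rfix_mx S N).
  exact: normal_rfix_mx_module.
rewrite -sub1mx => /rfix_mxP fixN; rewrite /= remgr_RkE.
apply: (@Rk_class_iso _ _ _ (remgr_grepr S) S 1%:M); rewrite ?/row_free ?/row_full ?mxrank1 //.
move=> x Gx; rewrite /= mulmx1 mul1mx.
have NKx : x \in (N * K)%g by rewrite (sdprodW defG).
have Nx : divgr N K x \in N by apply: mem_divgr.
have [Gdx Grx] : divgr N K x \in G /\ remgr N K x \in G.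
  by rewrite (fintype.subsetP sNG) // (fintype.subsetP sKG) ?pi_in.
rewrite {2}(divgr_eq N K x) repr_mxM //.
by rewrite -[S (divgr _ _ _)]mul1mx fixN ?mul1mx.
Qed.

Lemma Rk_class_permrep_remgr (T : finType) (to to' : action G T) :
    {in G, forall x t, to' t x = to t (pi x)} ->
  Rk_class (permrep to' F) = Rk_class (permrep to F).
Proof.
move=> to'E; rewrite -[RHS]Rk_class_remgr.
apply: (@Rk_class_iso _ _ _ (permrep to' F) (remgr_grepr (permrep to F)) 1%:M).
- move=> x Gx; rewrite mulmx1 mul1mx; apply/matrixP=> i j.
  by rewrite [LHS]mxE [RHS]mxE to'E.
- by rewrite /row_free mxrank1.
by rewrite /row_full mxrank1.
Qed.

End Twisted.

(** * Semidirect products of a p-group and a p'-group *)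

Section Isolated.

Variables (p : nat) (gT : finGroupType).
Hypothesis pr_p : prime p.
Implicit Types G H A K : {group gT}.

Lemma p_isolatedS G H : H \subset G -> p_isolated p G -> p_isolated p H.
Proof. by move=> sHG isoG x q /(fintype.subsetP sHG); apply: isoG. Qed.

(** If both were nontrivial, suitable powers of them would have order [p] and a prime order [q]
    other than [p], and the product of these powers would have order [p * q]. *)
Lemma p_isolated_commute G x y : p_isolated p G -> x \in G -> y \in G ->
  p.-elt x -> p^'.-elt y -> commute x y -> (x == 1%g) || (y == 1%g).
Proof.
move=> isoG Gx Gy px p'y cxy; apply: contraT; rewrite negb_or => /andP[ntx nty].
have [q pr_q q_y] : exists2 q, prime q & (q %| #[y])%N.
  exists (pdiv #[y]); rewrite ?pdiv_dvd // pdiv_prime //.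
  by rewrite ltn_neqAle order_gt0 eq_sym order_eq1 nty.
have qp : q != p by move/pnatP: p'y => /(_ (order_gt0 y) q pr_q q_y).
have p_x : (p %| #[x])%N.
  have [_ ] : prime p /\ (p %| #|<[x]>|)%N by case: (pgroup_pdiv px); rewrite ?cycle_eq1.
  by [].
have [x1 xx1 ox1] := Cauchy pr_p (p_x : (p %| #|<[x]>|)%N).
have [y1 yy1 oy1] := Cauchy pr_q (q_y : (q %| #|<[y]>|)%N).
have cxy1 : commute x1 y1.
  have /cyclePmin[i _ ->] := xx1; have /cyclePmin[j _ ->] := yy1.
  exact/commuteX2.
have Gx1 : x1 \in G by apply: (fintype.subsetP _ _ xx1); rewrite cycle_subG.
have Gy1 : y1 \in G by apply: (fintype.subsetP _ _ yy1); rewrite cycle_subG.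
case: (isoG (x1 * y1)%g q) => //; first by rewrite groupM.
rewrite orderM // ?ox1 ?oy1 // prime_coprime // dvdn_prime2 // eq_sym.
exact: qp.
Qed.

(** Up to a left factor in [K], [x] is an element [a] of [A]. For [u] in [K] and [K :^ a], the
    commutator of [u] and [a^-1] lies in both [A] and [K], so [u] and [a] commute. *)
Lemma sdprod_TI G A K x : A ><| K = G ->
    {in A & K, forall a u, commute a u -> (a == 1%g) || (u == 1%g)} ->
  x \in G -> x \notin K -> K :&: K :^ x = 1%g.
Proof.
case/sdprodP=> _ defG nAK tiAK regAK Gx notKx; apply/trivgP/subsetP=> u /setIP[Ku].
have GE : (G : {set gT}) = (K * A)%g by rewrite -defG (normC nAK).
move: Gx; rewrite GE => /mulsgP[y a Ky Aa xE].
rewrite /= xE conjsgM (conjGid Ky) mem_conjg => Kua.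
have cua : [~ u, a^-1] = 1%g.
  apply/set1gP; rewrite -tiAK inE; apply/andP; split; last first.
    by rewrite commgEl groupM ?groupV.
  by rewrite commgEr groupM ?groupV // memJ_norm ?groupV // (fintype.subsetP nAK).
have /regAK : commute a u.
  by rewrite -[a]invgK; apply/commute_sym/commuteV/commgP/eqP.
case/(_ Aa Ku)/orP=> /eqP => [a1|->]; last exact: group1.
by case/negP: notKx; rewrite xE a1 mulg1.
Qed.

End Isolated.

(** * Actions on cosets, on a point and on products *)

Section CosetAction.

Variables (gT : finGroupType) (K G : {group gT}).
Fact rcoset_act1 (A : {set gT}) : A :* 1%g = A.
Proof. exact: rcoset1. Qed.

Fact rcoset_actM : {in G &, forall x y (A : {set gT}), A :* (x * y)%g = A :* x :* y}.
Proof. by move=> x y _ _ A; rewrite rcosetM. Qed.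

Definition rmul_act := @mkact _ G {set gT} (fun A x => A :* x) rcoset_act1 rcoset_actM.

Fact rcosets_stable : {in G, forall x, {in rcosets K G, forall A, rmul_act A x \in rcosets K G}}.
Proof.
move=> x Gx _ /rcosetsP[y Gy ->]; rewrite mkactE // -rcosetM.
by apply/rcosetsP; exists (y * x)%g; rewrite ?groupM.
Qed.

Definition coset_act := restrict_act rcosets_stable.
Local Notation T := {A : {set gT} | A \in rcosets K G}.

Lemma val_coset_act (u : T) : {in G, forall x, val (coset_act u x) = val u :* x}.
Proof. by move=> x Gx; rewrite val_restrict_act // mkactE. Qed.

Lemma rcoset_eq_mul a x : (K :* a :* x == K :* a) = (x \in K :^ a).
Proof.
by rewrite -rcosetM (sameP eqP rcoset_eqP) mem_rcoset mem_conjg conjgE invgK mulgA.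
Qed.

Lemma coset_actE (u : T) a x : val u = K :* a -> x \in G -> (coset_act u x == u) = (x \in K :^ a).
Proof.
move=> uE Gx; by rewrite -(inj_eq val_inj) val_coset_act // uE rcoset_eq_mul.
Qed.

Lemma astab1_coset_act (u : T) a : val u = K :* a -> 'C_G[u | coset_act] = G :&: K :^ a.
Proof.
move=> uE; apply/setP=> x; rewrite astab1E inE; case Gx: (x \in G) => //=.
by rewrite (coset_actE uE).
Qed.

Lemma coset_val (u : T) : exists2 a, a \in G & val u = K :* a.
Proof. by have /rcosetsP[a Ga ->] := valP u; exists a. Qed.

Lemma card_coset_act : #|{: T}| = #|G : K|.
Proof. by rewrite card_sig; apply: eq_card => A; rewrite inE. Qed.

End CosetAction.
Arguments coset_act {gT} K G.

Definition point_act (gT : finGroupType) (G : {group gT}) : action G unit :=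
  @mkact gT G unit (fun t _ => t) (fun=> erefl) (fun _ _ _ _ _ => erefl).

Lemma Rk_class_twist_point (gT : finGroupType) (G : {group gT}) (F k : fieldType)
    (phi : {rmorphism F -> k}) (V : representation k G) :
  twist_Rk phi V (Rk_class (permrep (point_act G) F)) = Rk_class V.
Proof. by apply: (@twist_point _ _ _ _ _ _ _ _ tt) => -[]. Qed.

Section ProductAction.

Variables (gT : finGroupType) (G : {group gT}) (T1 T2 : finType).
Variables (to1 : action G T1) (to2 : action G T2).

Definition prod_fun (t : T1 * T2) x := (to1 t.1 x, to2 t.2 x).

Fact prod_fun1 t : prod_fun t 1%g = t.
Proof. by case: t => a b; rewrite /prod_fun !act1. Qed.

Fact prod_funM : {in G &, forall x y t, prod_fun t (x * y)%g = prod_fun (prod_fun t x) y}.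
Proof. by move=> x y Gx Gy t; rewrite /prod_fun !actMin. Qed.

Definition prod_act := mkact prod_fun1 prod_funM.

Lemma prod_actE a b : {in G, forall x, prod_act (a, b) x = (to1 a x, to2 b x)}.
Proof. by move=> x Gx; rewrite mkactE. Qed.

End ProductAction.

(* When pairs of distinct points have trivial stabilisers and [#|T| = 1] in [F],
   [1 - J], with [J] the all-ones matrix, is an idempotent endomorphism of [F[T]]
   whose kernel is trivial of rank 1; it is minus the sum of the conjugates of the
   indicator matrix of a transversal of the regular orbits of [G] on such pairs,
   hence its image is projective. *)
Section Augmentation.

Variables (gT : finGroupType) (G : {group gT}) (T : finType) (to : action G T).
Hypothesis freeT2 :
  forall x a b, x \in G -> a != b -> to a x = a -> to b x = b -> x = 1%g.

Lemma pair_transversal : exists R : {set T * T}, forall a b,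
  (\sum_(x in G) ((to a x, to b x) \in R))%N = (a != b).
Proof.
pose pto := prod_act to to; pose D := [set t : T * T | t.1 != t.2].
have actsD : [acts G, on D | pto].
  apply/subsetP=> x Gx; rewrite !inE Gx /=; apply/subsetP=> -[a b] Dab.
  suff Dx : pto (a, b) x \in D by rewrite inE.
  rewrite prod_actE //; move: Dab; rewrite !inE /=.
  by apply: contraNneq => ab; rewrite -[a](actKin to Gx) ab actKin.
have [_ sXD X1 X2] := orbit_transversalP actsD.
exists (orbit_transversal pto G D) => a b.
have [-> | ab] := eqVneq a b.
  by rewrite big1 // => x _; case: (boolP (_ \in _)) => // /(fintype.subsetP sXD); rewrite inE eqxx.
have [|x0 Gx0] := X2 (a, b); first by rewrite inE.
rewrite prod_actE // => X0.
rewrite (bigD1 x0) //= X0 big1 // => x /andP[Gx xx0].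
case: (boolP (_ \in _)) => // Xx; case/eqP: xx0.
have : (to a x, to b x) \in orbit pto G (to a x0, to b x0).
  apply/orbitP; exists (x0^-1 * x)%g; rewrite ?groupM ?groupV //.
  by rewrite prod_actE ?groupM ?groupV // -!actMin ?groupM ?groupV // !mulKVg.
rewrite X1 // => /eqP[ea eb].
have y1 : (x * x0^-1 = 1)%g.
  apply: (freeT2 _ ab); rewrite ?groupM ?groupV //.
    by rewrite actMin ?groupV // -ea actKin.
  by rewrite actMin ?groupV // -eb actKin.
by apply/eqP; rewrite eq_mulgV1 y1.
Qed.

Variable F : fieldType.
Hypothesis cardT : #|T|%:R = 1 :> F.

Local Notation M := (actmx to F).
Local Notation J := (const_mx 1 : 'M[F]_#|T|).

Lemma mul_actmx n (A : 'M[F]_(#|T|, n)) x i j :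
  (M x *m A) i j = A (enum_rank (to (enum_val i) x)) j.
Proof.
rewrite mxE (bigD1 (enum_rank (to (enum_val i) x))) //= !mxE enum_rankK eqxx mul1r.
rewrite big1 ?addr0 // => l; rewrite -(inj_eq enum_val_inj) enum_rankK eq_sym mxE.
by move/negPf->; rewrite mul0r.
Qed.

Lemma mulmx_act n (A : 'M[F]_(n, #|T|)) x i j : x \in G ->
  (A *m M x) i j = A i (enum_rank (to (enum_val j) (x^-1)%g)).
Proof.
move=> Gx; rewrite mxE (bigD1 (enum_rank (to (enum_val j) (x^-1)%g))) //= !mxE enum_rankK.
rewrite actKVin // eqxx mulr1 big1 ?addr0 // => l.
rewrite -(inj_eq enum_val_inj) enum_rankK -(can2_eq (actKin to Gx) (actKVin to Gx)) mxE.
by move/negPf->; rewrite mulr0.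
Qed.

Lemma trace_augmentation : exists phi : 'M[F]_#|T|,
  \sum_(x in G) M (x^-1)%g *m phi *m M x = 1%:M - J.
Proof.
have [R RE] := pair_transversal.
exists (\matrix_(i, j) - ((enum_val i, enum_val j) \in R)%:R).
apply/matrixP=> i j; rewrite summxE (reindex_inj invg_inj) /=.
under eq_bigl => x do rewrite groupV.
rewrite (eq_bigr (fun x => - ((to (enum_val i) x, to (enum_val j) x) \in R)%:R)); last first.
  by move=> x Gx; rewrite mulmx_act ?groupV // mul_actmx mxE !enum_rankK !invgK.
rewrite sumrN -natr_sum RE !mxE (inj_eq enum_val_inj).
by case: eqP => _; rewrite ?subrr ?oppr0 // sub0r.
Qed.

Lemma Rk_class_augmentation : exists2 U : representation F G, higman U &
  Rk_class (permrep to F) = Rk_class U + Rk_class (permrep (point_act G) F).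
Proof.
have MJ x : M x *m J = J by apply/matrixP=> i j; rewrite mul_actmx !mxE.
have JM x : x \in G -> J *m M x = J.
  by move=> Gx; apply/matrixP=> i j; rewrite mulmx_act // !mxE.
(* [g] is the augmentation, and [g'] is a section of it because [#|T|] is 1 in [F]; hence [1%:M - J]
   projects onto the kernel of [g]. *)
pose g : 'M[F]_(#|T|, #|{: unit}|) := const_mx 1.
pose g' : 'M[F]_(#|{: unit}|, #|T|) := const_mx 1.
have unit1 : #|{: unit}| = 1%N by rewrite card_unit.
have unitE (a b : unit) : a == b by case: a b => -[].
have gg' : g *m g' = J.
  apply/matrixP=> i j; rewrite !mxE (eq_bigr (fun=> 1)) => [|l _]; last by rewrite !mxE mulr1.
  by rewrite sumr_const card_ord unit1.
have g'g : g' *m g = 1%:M.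
  apply/matrixP=> i j; rewrite !mxE (eq_bigr (fun=> 1)) => [|l _]; last by rewrite !mxE mulr1.
  rewrite sumr_const card_ord cardT; case: eqP => // -[]; apply: enum_val_inj.
  exact/eqP/unitE.
have hg : @grepr_hom _ _ _ (permrep to F) (permrep (point_act G) F) g.
  move=> x Gx; apply/matrixP=> i j; rewrite mul_actmx !mxE.
  rewrite (bigD1 (enum_rank tt)) //= big1 ?addr0 => [|l /negP[]].
    rewrite !mxE mul1r.
    by case: (_ == _) (unitE (point_act G (enum_val (enum_rank tt)) x) (enum_val j)).
  by apply/eqP/enum_val_inj/eqP; apply: unitE.
pose kg := kermx g.
have modk : mxmodule (permrep to F) kg.
  apply/mxmoduleP=> x Gx; apply/sub_kermxP.
  by rewrite -mulmxA hg // mulmxA mulmx_ker mul0mx.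
pose U : representation F G := Representation (submod_repr modk).
pose f : 'M_(rdegree U, rdegree (permrep to F)) := val_submod 1%:M.
pose e : 'M[F]_#|T| := 1%:M - J.
have ek : (e <= kg)%MS.
  by apply/sub_kermxP; rewrite mulmxBl mul1mx -gg' -mulmxA g'g mulmx1 subrr.
have hf : @grepr_hom _ _ _ U (permrep to F) f.
  by move=> x Gx; rewrite /f -val_submodE -[submod_repr _ _]mul1mx val_submodJ.
have fg0 : f *m g = 0 by apply/sub_kermxP; apply: val_submodP.
have fe : f *m e = f by rewrite mulmxBr mulmx1 -gg' mulmxA fg0 mul0mx subr0.
pose s : 'M_(rdegree (permrep to F), rdegree U) := in_submod kg e.
have [phi phiE] := trace_augmentation.
exists U.
  apply: (@higman_summand _ _ _ U (permrep to F) f s phi) => //.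
  - move=> x Gx; rewrite /s -in_submodJ //= [e *m _]mulmxBl mul1mx JM //.
    by rewrite in_submodE [in RHS]in_submodE mulmxA mulmxBr mulmx1 MJ.
  - by rewrite /s in_submodE mulmxA fe -in_submodE val_submodK.
  by rewrite phiE /s /f -val_submodE in_submodK.
apply: (@Rk_class_exact _ _ _ U (permrep to F) (permrep (point_act G) F) f g).
apply: short_exactI => //.
- by rewrite /row_free /f val_submod1.
- by apply/row_fullP; exists g'.
have rg : \rank g = #|{: unit}| by apply/eqP; rewrite -/(row_full g); apply/row_fullP; exists g'.
by rewrite /= mxrank_ker rg subnK // -{1}rg rank_leq_row.
Qed.

End Augmentation.

Section SemidirectCase.

Variables (p : nat) (k : fieldType) (phi : {rmorphism 'F_p -> k}).
Hypotheses (pr_p : prime p) (pk : p \in [pchar k]).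
Variables (gT : finGroupType) (G A K : {group gT}).
Hypotheses (isoG : p_isolated p G) (defG : A ><| K = G).

Let sAG : A \subset G. Proof. by case/sdprod_context: defG => /andP[]. Qed.
Let sKG : K \subset G. Proof. by case/sdprod_context: defG. Qed.
Let cardG : (#|G : K| = #|A|)%N.
Proof. by rewrite -divgS // -(sdprod_card defG) mulnK. Qed.

(** After a conjugation, the stabilisers of two distinct cosets become [K] and its conjugate by an
    element outside [K], which meet trivially. *)
Lemma coset_fixed_pair x (u v : {B : {set gT} | B \in rcosets K G}) :
    {in A & K, forall a y, commute a y -> (a == 1%g) || (y == 1%g)} ->
  x \in G -> u != v -> coset_act K G u x = u -> coset_act K G v x = v -> x = 1%g.
Proof.
move=> regAK Gx uv; have [a Ga uE] := coset_val u; have [b Gb vE] := coset_val v.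
move/eqP; rewrite (coset_actE uE Gx) => xKa.
move/eqP; rewrite (coset_actE vE Gx) => xKb.
have ab : (b * a^-1)%g \notin K.
  apply: contra uv => Kab; rewrite -(inj_eq val_inj) uE vE; apply/eqP/esym/rcoset_eqP.
  by rewrite mem_rcoset.
have : (x ^ a^-1)%g \in K :&: K :^ (b * a^-1)%g.
  by rewrite inE !mem_conjg -conjgM invMg invgK mulKg -!mem_conjg xKa.
rewrite (sdprod_TI defG regAK (groupM Gb (groupVr Ga)) ab) => /set1gP/eqP.
by rewrite conjg_eq1 => /eqP.
Qed.

Lemma ind_span_p'_p (V : representation k G) :
  p^'.-group A -> p.-group K -> ind_span p (Rk_class V).
Proof.
move=> p'A pK; have [K1 | ntK] := eqVneq (K : {set gT}) 1%g.
  apply/zgen_gen/ProjGen/higman_projective/(higman_pchar' V pk).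
  by rewrite -(sdprodW defG) K1 mulg1.
have regAK : {in A & K, forall a y, commute a y -> (a == 1%g) || (y == 1%g)}.
  move=> a y Aa Ky cay; rewrite orbC.
  apply: (p_isolated_commute pr_p isoG (fintype.subsetP sKG y Ky) (fintype.subsetP sAG a Aa)).
  - exact: mem_p_elt pK Ky.
  - exact: mem_p_elt p'A Aa.
  exact: commute_sym.
(* The p-group [K] acts on [A] by conjugation and fixes only 1, so the order of [A] is 1 modulo
   [p]. *)
have cardA : #|A|%:R = 1 :> 'F_p.
  have actsK : [acts K, on A | 'J].
    by rewrite astabsJ; case/sdprodP: defG.
  have cAK1 : 'Fix_(A | 'J)(K) = 1%g.
    have [y Ky nty] := trivgPn _ ntK.
    rewrite afixJ; apply/trivgP/subsetP=> a /setIP[Aa cKa].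
    have /orP[/eqP-> //|y1] := regAK a y Aa Ky (centP cKa y Ky).
    by rewrite y1 in nty.
  have := pgroup_fix_mod pK actsK; rewrite cAK1 cards1 => cA.
  by rewrite -(Fp_nat_mod pr_p) cA Fp_nat_mod.
have [| |U hU cU] := @Rk_class_augmentation gT G _ (coset_act K G) _ 'F_p.
- by move=> x u v; apply: coset_fixed_pair.
- by rewrite card_coset_act // cardG.
(* The first term is a sum of classes induced from subgroups of conjugates of [K], and the second is
   the class of a projective module. *)
have -> : Rk_class V = twist_Rk phi V (Rk_class (permrep (coset_act K G) 'F_p))
   - twist_Rk phi V (Rk_class U).
  by rewrite -raddfB /= cU addrC addKr Rk_class_twist_point.
apply: ind_spanB.
  apply: ind_span_permrep => u; apply: ind_good_pgroup.
  have [a Ga uE] := coset_val u.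
  rewrite /= (astab1_coset_act uE); apply: pgroupS (subsetIr _ _) _.
  by rewrite pgroupJ.
by rewrite twist_RkE; apply/zgen_gen/ProjGen/higman_projective/higman_twist.
Qed.

Lemma ind_span_p_p' (V : representation k G) :
  p.-group A -> p^'.-group K -> ind_span p (Rk_class V).
Proof.
move=> pA p'K.
have regAK : {in A & K, forall a y, commute a y -> (a == 1%g) || (y == 1%g)}.
  move=> a y Aa Ky cay.
  apply: (p_isolated_commute pr_p isoG (fintype.subsetP sAG a Aa) (fintype.subsetP sKG y Ky)) => //.
    exact: mem_p_elt pA Aa.
  exact: mem_p_elt p'K Ky.
pose T := {B : {set gT} | B \in rcosets K G}; pose to := coset_act K G.
have piK x : x \in G -> remgr A K x \in K.
  by rewrite -{1}(sdprodW defG); apply: mem_remgr.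
have piG x : x \in G -> remgr A K x \in G.
  by move/piK; apply: (fintype.subsetP sKG).
(* The same cosets, with [G] acting through its projection onto [K]. The class of the permutation
   module is unchanged, but the coset [K] becomes a fixed point and contributes the trivial
   module. *)
pose fpi (t : T) x := to t (remgr A K x).
have fpi1 t : fpi t 1%g = t by rewrite /fpi remgr1 ?group1 // act1.
have fpiM : {in G &, forall x y t, fpi t (x * y)%g = fpi (fpi t x) y}.
  move=> x y Gx Gy t; rewrite /fpi -actMin ?piG //.
  have [nsAG _ AK _ tiAK] := sdprod_context defG.
  by rewrite (@remgrM _ A K G) //; apply/complP.
pose pto := mkact fpi1 fpiM.
have ptoE : Rk_class (permrep pto 'F_p) = Rk_class (permrep to 'F_p).
  apply: (Rk_class_permrep_remgr (pchar_Fp pr_p) pA defG) => x Gx t.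
  by rewrite mkactE.
have Ko : (K : {set gT}) \in rcosets K G by apply/rcosetsP; exists 1%g; rewrite ?rcoset1.
pose o : T := exist _ (K : {set gT}) Ko.
have oP u a : val u = K :* a -> (u == o) = (a \in K).
  move=> uE; rewrite -(inj_eq val_inj) uE /= -{2}[K : {set gT}]rcoset1.
  by rewrite (sameP eqP rcoset_eqP) rcoset1.
have fix_o : {in G, forall x, pto o x = o}.
  move=> x Gx; rewrite mkactE // /fpi; apply: val_inj.
  by rewrite val_coset_act ?piG //= rcoset_id ?piK.
have stS : {in G, forall x, {in [set~ o], forall t, pto t x \in [set~ o]}}.
  move=> x Gx t; rewrite !inE; apply: contra => /eqP tx.
  by rewrite -(actKin pto Gx t) tx fix_o ?groupV.
have ptoS : Rk_class (permrep pto 'F_p) =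
    Rk_class (permrep (point_act G) 'F_p) + Rk_class (permrep (restrict_act stS) 'F_p).
  apply: (@permrep_split _ _ _ _ _ _ _ _ _ (fun=> o) val).
  - by move=> [] [].
  - exact: val_inj.
  - by move=> _ v; have := valP v; rewrite !inE eq_sym.
  - rewrite card_unit -(cardsC [set o]) cards1 [in RHS]card_sig.
    by congr (_ + _)%N; apply: eq_card => t; rewrite !inE.
  - by move=> x Gx t; rewrite fix_o.
  by move=> x Gx t; rewrite val_restrict_act.
have -> : Rk_class V = twist_Rk phi V (Rk_class (permrep to 'F_p))
   - twist_Rk phi V (Rk_class (permrep (restrict_act stS) 'F_p)).
  by rewrite -raddfB /= -ptoE ptoS addrK Rk_class_twist_point.
apply: ind_spanB; apply: ind_span_permrep => u.
  apply: ind_good_projective => W; apply/higman_projective/(higman_pchar' W pk).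
  have [a Ga uE] := coset_val u.
  rewrite /= (astab1_coset_act uE); apply: pgroupS (subsetIr _ _) _.
  by rewrite pgroupJ.
apply: ind_good_pgroup; rewrite /= astab1_restrict_act.
have [a Ga uE] := coset_val (val u).
have aK : a \notin K by rewrite -(oP _ _ uE); have := valP u; rewrite !inE.
(* An element fixing another coset [K :* a] projects into both [K] and [K :^ a], hence to 1, and so
   lies in [A]. *)
apply: pgroupS pA; apply/subsetP=> x; rewrite astab1E => /andP[Gx].
rewrite mkactE // /fpi (coset_actE uE (piG x Gx)) => pix.
have : remgr A K x \in K :&: K :^ a by rewrite inE piK.
rewrite (sdprod_TI defG regAK Ga aK) => /set1gP pix1.
have AKx : x \in (A * K)%g by rewrite (sdprodW defG).
by rewrite (divgr_eq A K x) pix1 mulg1 mem_divgr.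
Qed.

End SemidirectCase.

(** * The ring of permutation characters *)

Section Family.

Variables (p : nat) (gT : finGroupType).
Hypothesis pr_p : prime p.
Implicit Types G H L A K C : {group gT}.

(* [H] has a normal Sylow p-subgroup or a normal p-complement. *)
Definition p_split H := exists A : {group gT}, A <| H /\
  (p.-group A && p^'.-nat #|H : A| || p^'.-group A && p.-nat #|H : A|).

(** Closure under subgroups is what makes the characters below closed under products. *)
Lemma p_splitS L H : L \subset H -> p_split H -> p_split L.
Proof.
move=> sLH [A [nsAH pA]]; exists (L :&: A)%G; split; first exact: normalGI nsAH.
have [sAH nAH] := andP nsAH.
have dvdLA : (#|L : L :&: A| %| #|H : A|)%N.
  rewrite indexgI -indexMg -norm_joinEr ?(subset_trans sLH) //.
  by apply: indexSg; rewrite ?joing_subl // join_subG sAH.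
case/orP: pA => /andP[piA piHA]; apply/orP; [left | right].
  by rewrite (pgroupS (subsetIr _ _) piA) (pnat_dvd dvdLA).
by rewrite (pgroupS (subsetIr _ _) piA) (pnat_dvd dvdLA).
Qed.

Lemma p_splitJ H x : p_split H -> p_split (H :^ x)%G.
Proof.
case=> A [nsAH pA]; exists (A :^ x)%G; split; first by rewrite normalJ.
by rewrite /= !pgroupJ indexJg.
Qed.

(** In either case [A] is a normal Hall subgroup, so Schur-Zassenhaus provides a complement and [H]
    is a semidirect product of the kind already treated. *)
Lemma ind_span_p_split (k : fieldType) (phi : {rmorphism 'F_p -> k}) H
    (V : representation k H) :
  p \in [pchar k] -> p_isolated p H -> p_split H -> ind_span p (Rk_class V).
Proof.
move=> pk isoH [A [nsAH pA]]; have sAH := normal_sub nsAH.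
have hallA : Hall H A.
  rewrite /Hall sAH /=; case/orP: pA => /andP[piA piHA]; first exact: pnat_coprime piA piHA.
  by rewrite coprime_sym; apply: pnat_coprime piHA piA.
have /splitsP[K /complP[tiAK AKH]] := SchurZassenhaus_split hallA nsAH.
have defH : A ><| K = H.
  rewrite sdprodE //; apply: subset_trans (normal_norm nsAH).
  by rewrite -AKH mulG_subr.
have oK : #|H : A| = #|K| by rewrite -divgS // -(sdprod_card defH) mulKn.
rewrite oK in pA; case/orP: pA => /andP[piA piK].
  exact: (ind_span_p_p' phi pr_p pk isoH defH).
exact: (ind_span_p'_p phi pr_p pk isoH defH).
Qed.

Lemma fixnumE G (T : finType) (to : action G T) x :
  fixnum to x = (\sum_t (to t x == t))%N.
Proof. by rewrite /fixnum -sum1dep_card big_mkcond; apply: eq_bigr => t _; case: eqP. Qed.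

Lemma fixnum_prod G (T1 T2 : finType) (to1 : action G T1) (to2 : action G T2) x :
  x \in G -> fixnum (prod_act to1 to2) x = (fixnum to1 x * fixnum to2 x)%N.
Proof.
move=> Gx; rewrite !fixnumE big_distrlr pair_big /=; apply: eq_bigr => -[a b] _.
by rewrite [guarded_act _ _ _ _]prod_actE // xpair_eqE mulnb.
Qed.

Section SumAction.

Variables (G : {group gT}) (T1 T2 : finType) (to1 : action G T1) (to2 : action G T2).

Definition sum_fun (t : T1 + T2) x : T1 + T2 :=
  match t with inl a => inl (to1 a x) | inr b => inr (to2 b x) end.

Fact sum_fun1 t : sum_fun t 1%g = t.
Proof. by case: t => a /=; rewrite act1. Qed.

Fact sum_funM : {in G &, forall x y t, sum_fun t (x * y)%g = sum_fun (sum_fun t x) y}.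
Proof. by move=> x y Gx Gy [] a /=; rewrite actMin. Qed.

Definition sum_act := mkact sum_fun1 sum_funM.

Lemma sum_actE t : {in G, forall x, sum_act t x = sum_fun t x}.
Proof. by move=> x Gx; rewrite mkactE. Qed.

Lemma fixnum_sum x : x \in G -> fixnum sum_act x = (fixnum to1 x + fixnum to2 x)%N.
Proof.
move=> Gx; rewrite !fixnumE big_sumType /=.
by congr (_ + _)%N; apply: eq_bigr => t _; rewrite [guarded_act _ _ _ _]sum_actE.
Qed.

Lemma Rk_class_permrep_sum (F : fieldType) :
  Rk_class (permrep sum_act F) = Rk_class (permrep to1 F) + Rk_class (permrep to2 F).
Proof.
apply: (@permrep_split _ _ _ _ _ _ _ _ _ inl inr) => //.
- by move=> a b [].
- by move=> a b [].
- by rewrite card_sum.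
- by move=> x Gx t; rewrite sum_actE.
by move=> x Gx t; rewrite sum_actE.
Qed.

End SumAction.

Definition p_split_act G (T : finType) (to : action G T) :=
  forall t, p_split 'C_G[t | to]%G.

(** These are the virtual permutation characters of the family, viewed as integral functions of
    which only the values on [G] are constrained. *)
Definition split_char G (f : gT -> int) :=
  exists (T1 T2 : finType) (to1 : action G T1) (to2 : action G T2),
  [/\ p_split_act to1, p_split_act to2 &
      {in G, forall x, f x = (fixnum to1 x)%:Z - (fixnum to2 x)%:Z}].

Lemma p_split_prod G (T1 T2 : finType) (to1 : action G T1) (to2 : action G T2) :
  p_split_act to1 -> p_split_act (prod_act to1 to2).
Proof.
move=> s1 [a b]; apply: p_splitS (s1 a); apply/subsetP=> x.
by rewrite !astab1E => /andP[Gx]; rewrite Gx prod_actE // xpair_eqE => /andP[].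
Qed.

Lemma p_split_sum G (T1 T2 : finType) (to1 : action G T1) (to2 : action G T2) :
  p_split_act to1 -> p_split_act to2 -> p_split_act (sum_act to1 to2).
Proof.
move=> s1 s2 [a | b]; [apply: p_splitS (s1 a) | apply: p_splitS (s2 b)].
  by apply/subsetP=> x; rewrite !astab1E => /andP[Gx]; rewrite Gx sum_actE.
by apply/subsetP=> x; rewrite !astab1E => /andP[Gx]; rewrite Gx sum_actE.
Qed.

Definition void_act G : action G void :=
  @mkact gT G void (fun t _ => t) (fun=> erefl) (fun _ _ _ _ _ => erefl).

Lemma fixnum_void G x : fixnum (void_act G) x = 0%N.
Proof. by apply: eq_card0 => -[]. Qed.

Lemma split_char_fixnum G (T : finType) (to : action G T) :
  p_split_act to -> split_char G (fun x => (fixnum to x)%:Z).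
Proof.
move=> s; exists T, void, to, (void_act G); split=> // x _.
by rewrite fixnum_void subr0.
Qed.

Lemma eq_split_char G f g : {in G, f =1 g} -> split_char G f -> split_char G g.
Proof.
move=> fg [T1 [T2 [to1 [to2 [s1 s2 fE]]]]]; exists T1, T2, to1, to2.
by split=> // x Gx; rewrite -fg // fE.
Qed.

Lemma split_char0 G : split_char G (fun=> 0).
Proof.
by apply: eq_split_char (@split_char_fixnum G _ (void_act G) _) => [x _|[]]; rewrite fixnum_void.
Qed.

Lemma split_charN G f : split_char G f -> split_char G (fun x => - f x).
Proof.
case=> T1 [T2 [to1 [to2 [s1 s2 fE]]]]; exists T2, T1, to2, to1; split=> // x Gx.
by rewrite fE // opprB.
Qed.

Lemma split_charD G f g : split_char G f -> split_char G g -> split_char G (fun x => f x + g x).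
Proof.
case=> T1 [T2 [to1 [to2 [s1 s2 fE]]]] [U1 [U2 [uo1 [uo2 [u1 u2 gE]]]]].
exists (T1 + U1)%type, (T2 + U2)%type, (sum_act to1 uo1), (sum_act to2 uo2).
split=> [||x Gx]; try exact: p_split_sum.
by rewrite fE // gE // !fixnum_sum // !PoszD opprD addrACA.
Qed.

Lemma split_charM G f g : split_char G f -> split_char G g -> split_char G (fun x => f x * g x).
Proof.
case=> T1 [T2 [to1 [to2 [s1 s2 fE]]]] [U1 [U2 [uo1 [uo2 [u1 u2 gE]]]]].
exists (T1 * U1 + T2 * U2)%type, (T1 * U2 + T2 * U1)%type.
exists (sum_act (prod_act to1 uo1) (prod_act to2 uo2)).
exists (sum_act (prod_act to1 uo2) (prod_act to2 uo1)).
split=> [||x Gx]; try by apply: p_split_sum; apply: p_split_prod.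
rewrite fE // gE // !fixnum_sum // !fixnum_prod // !PoszD !PoszM.
by rewrite mulrBl !mulrBr opprB addrACA -opprD.
Qed.

Lemma split_charMz G f (c : int) : split_char G f -> split_char G (fun x => c * f x).
Proof.
move=> sf; have sMn n : split_char G (fun x => n%:Z * f x).
  elim: n => [|n IHn]; first by apply: eq_split_char (split_char0 G) => x _; rewrite mul0r.
  by apply: eq_split_char (split_charD sf IHn) => x _; rewrite intS mulrDl mul1r.
case: c => n; first exact: sMn.
by apply: eq_split_char (split_charN (sMn n.+1)) => x _; rewrite NegzE mulNr.
Qed.

(* The values at [x] form an ideal of the integers contained in no [q Z]. *)
Lemma split_char_value1 G x : x \in G ->
    (forall q, prime q -> exists2 f, split_char G f & ~~ (q %| f x)%Z) ->
  exists2 f, split_char G f & f x = 1.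
Proof.
move=> Gx local_f.
suff gen n : (0 < n)%N -> (exists2 f, split_char G f & f x = n%:Z) ->
    exists2 f, split_char G f & f x = 1.
  have [f sf f0] := local_f 2 isT.
  have fx0 : f x != 0 by apply: contraNneq f0 => ->; apply: dvdz0.
  apply: (gen `|f x|%N); first by rewrite absz_gt0.
  exists (fun y => Num.sg (f x) * f y); first exact: split_charMz.
  by rewrite abszE -Num.Theory.normrEsg.
have [m] := ubnP n; elim: m n => // m IHm n lenm n_gt0 [f sf fx].
have [n1 | n_neq1] := eqVneq n 1%N; first by exists f; rewrite // fx n1.
have n_gt1 : (1 < n)%N by rewrite ltn_neqAle eq_sym n_neq1.
(* Since [g x] is prime to a prime divisor of [n], its gcd with [n] is a proper divisor of [n], and
   Bezout's identity realises this gcd as a value. *)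
have [g sg gx] := local_f (pdiv n) (pdiv_prime n_gt1).
have [u [v uv]] := Bezoutz (f x) (g x).
pose d := gcdn n `|g x|%N; have d_gt0 : (0 < d)%N by rewrite gcdn_gt0 n_gt0.
apply: (IHm d) => //; last first.
  exists (fun y => u * f y + v * g y); last by rewrite uv fx /gcdz.
  by apply: split_charD; apply: split_charMz.
have d_n : (d %| n)%N by apply: dvdn_gcdl.
have : d != n.
  apply: contraNneq gx => dn; rewrite dvdzE /=; apply: dvdn_trans (pdiv_dvd n) _.
  by rewrite -dn dvdn_gcdr.
move: (dvdn_leq n_gt0 d_n); rewrite leq_eqVlt => /predU1P[->|ltdn]; first by rewrite eqxx.
by move=> _; apply: leq_trans ltdn _.
Qed.

Lemma split_char_one G :
    {in G, forall x q, prime q -> exists2 f, split_char G f & ~~ (q %| f x)%Z} ->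
  exists2 f, split_char G f & {in G, forall x, f x = 1}.
Proof.
move=> local_f.
suff [f sf f1] : exists2 f, split_char G f & {in enum G, forall x, f x = 1}.
  by exists f => // x Gx; apply: f1; rewrite mem_enum.
have : {subset enum G <= G} by move=> x; rewrite mem_enum.
elim: (enum G) => [|x s IHs] sG; first by exists (fun=> 0) => //; apply: split_char0.
have [|f sf f1] := IHs; first by move=> y sy; apply: sG; rewrite inE sy orbT.
have Gx : x \in G by apply: sG; rewrite mem_head.
have [g sg gx] := split_char_value1 Gx (local_f x Gx).
(* This is [1 - (1 - f) (1 - g)], which is 1 wherever [f] or [g] is. *)
exists (fun y => f y + (g y + - (f y * g y))).
  by apply: split_charD => //; apply: split_charD => //; apply/split_charN/split_charM.
move=> y; rewrite inE => /predU1P[-> | /f1->]; last by rewrite mul1r subrr addr0.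
by rewrite gx mulr1 addrCA subrr addr0.
Qed.

(** The p-part and the p'-part of [x] commute, so one of them is trivial. *)
Lemma p_elt_or_p'_elt G x : p_isolated p G -> x \in G -> p.-elt x \/ p^'.-elt x.
Proof.
move=> isoG Gx.
have /orP[/eqP xp | /eqP xp'] := p_isolated_commute pr_p isoG
    (groupX _ Gx : x.`_p \in G) (groupX _ Gx : x.`_p^' \in G)
    (p_elt_constt p x) (p_elt_constt p^' x) (commuteX2 _ _ (commute_refl x)).
  by right; rewrite -(consttC p x) xp mul1g p_elt_constt.
by left; rewrite -(consttC p x) xp' mulg1 p_elt_constt.
Qed.

(** * A coset action whose character at [x] is prime to [q] *)

Section LocalSubgroup.

Variables (G : {group gT}) (x : gT) (q : nat).
Hypotheses (Gx : x \in G) (pr_q : prime q).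
Let C := <[x.`_q^']>%G.
Let N := 'N_G(C)%G.
Variable Q : {group gT}.
Hypothesis sylQ : q.-Sylow(N) Q.
Let H := (C <*> Q)%G.

Let q'C : q^'.-group C. Proof. exact: p_elt_constt. Qed.
Let Nx : x \in N.
Proof.
rewrite inE Gx /=; apply: (fintype.subsetP (cent_sub _)).
by rewrite cent_cycle; apply/cent1P/commuteX.
Qed.
Let sCN : C \subset N. Proof. by rewrite cycle_subG groupX. Qed.
Let nsCH : C <| H.
Proof.
rewrite /normal joing_subl join_subG normG /=.
by apply: subset_trans (pHall_sub sylQ) _; apply: subsetIr.
Qed.
Let q_HC : q.-nat #|H : C|.
Proof.
rewrite /H /= norm_joinEr; last by apply: subset_trans (pHall_sub sylQ) (subsetIr _ _).
by rewrite indexMg; apply: pnat_dvd (dvdn_indexg _ _) (pHall_pgroup sylQ).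
Qed.

(** For [q = p], [C] is a normal p-complement of [H]. Otherwise [C] has index prime to [p]: it is a
    normal Sylow p-subgroup if [x] is a p-element, and [H] itself is a p'-group if [x] is a
    p'-element. *)
Lemma local_subgroup_p_split : p_isolated p G -> p_split H.
Proof.
move=> isoG; have [qp | qp] := eqVneq q p.
  by exists C; rewrite nsCH -qp q'C q_HC orbT.
have p'q : q \in (p^')%N by rewrite !inE.
have p'HC : p^'.-nat #|H : C| := pi_pnat q_HC p'q.
have [px | p'x] := p_elt_or_p'_elt isoG Gx.
  by exists C; rewrite nsCH p'HC andbT [p.-group C]p_eltX.
exists H; split; first exact: normal_refl.
apply/orP; right; apply/andP; split; last by rewrite indexgg.
by rewrite /pgroup -(Lagrange (normal_sub nsCH)) pnatM p'HC andbT; apply: p_eltX.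
Qed.

(* A coset of [H] fixed by [x] is fixed by the q'-part of [x], which generates
   the normal Hall q'-subgroup [C] of [H], so it lies in [N = 'N_G(C)]; on cosets
   of [H] in [N] only the q-part of [x] acts, and [q] does not divide [#|N : H|]. *)
Lemma local_subgroup_fixnum : ~~ (q %| fixnum (coset_act H G) x)%N.
Proof.
have hallC : q^'.-Hall(H) C by rewrite /pHall normal_sub // q'C pnatNK.
pose z := x.`_q; have Nz : z \in N by apply: groupX.
have xE : x = (z * x.`_q^')%g by rewrite consttC.
pose S := [set A in rcosets H N | A :* z == A].
have fixS : fixnum (coset_act H G) x = #|S|.
  rewrite /fixnum -(card_imset _ val_inj); apply: eq_card => A.
  apply/imsetP/idP=> [[u] | ].
    have [g Gg uE] := coset_val u.
    rewrite !inE (coset_actE uE Gx) => xHg ->; rewrite uE.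
    have Hg_in n : (x ^+ n)%g \in H :^ g by apply: groupX.
    have Ng : g \in N.
      rewrite inE Gg /= -groupV inE /= -cycleJ cycle_subG.
      rewrite -/(C : {set gT}) (mem_normal_Hall hallC nsCH); last first.
        by rewrite -mem_conjg; apply: Hg_in.
      by rewrite p_eltJ p_elt_constt.
    apply/andP; split; first by apply/rcosetsP; exists g.
    by rewrite rcoset_eq_mul; apply: Hg_in.
  rewrite inE => /andP[/rcosetsP[g Ng ->]]; rewrite rcoset_eq_mul => zHg.
  have [Gg nCg] := setIP Ng.
  have HgG : H :* g \in rcosets H G by apply/rcosetsP; exists g.
  exists (exist _ (H :* g) HgG) => //; rewrite inE (coset_actE (a := g)) //.
  rewrite [X in X \in _]xE groupM // mem_conjg.
  apply: (fintype.subsetP (normal_sub nsCH)).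
  by rewrite memJ_norm ?groupV // cycle_id.
have actsz : [acts <[z]>, on rcosets H N | 'Rs].
  apply: subset_trans (actsRs_rcosets H N); by rewrite cycle_subG.
have := pgroup_fix_mod (p_elt_constt q x : q.-group <[z]>) actsz.
have -> : 'Fix_(rcosets H N | 'Rs)(<[z]>) = S.
  apply/setP=> A; rewrite !inE; congr (_ && _).
  apply/subsetP/eqP=> [fixA | Az y /cycleP[n ->]].
    by have := fixA z (cycle_id z); rewrite inE /= rcosetE => /eqP.
  rewrite inE /= rcosetE; apply/eqP.
  by elim: n => [|n IHn]; rewrite ?expg0 /= ?rcoset1 // expgSr rcosetM [A :* _]IHn.
rewrite fixS => cS; rewrite /dvdn -cS -/(dvdn _ _).
rewrite -p'natE //; have /and3P[sQN _ q'NQ] := sylQ.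
by apply: pnat_dvd q'NQ; apply: indexgS; apply: joing_subr.
Qed.

End LocalSubgroup.

Lemma split_char1 G : p_isolated p G ->
  exists2 f, split_char G f & {in G, forall x, f x = 1}.
Proof.
move=> isoG; apply: split_char_one => x Gx q pr_q.
have [Q sylQ] := Sylow_exists q 'N_G(<[x.`_q^']>).
pose H := (<[x.`_q^']> <*> Q)%G.
exists (fun y => (fixnum (coset_act H G) y)%:Z); last first.
  by rewrite dvdzE; apply: local_subgroup_fixnum.
apply: split_char_fixnum => u; have [a Ga uE] := coset_val u.
apply: p_splitS (p_splitJ a (local_subgroup_p_split Gx sylQ isoG)).
by rewrite /= (astab1_coset_act uE) subsetIr.
Qed.

End Family.

(** * From the constant character 1 to surjectivity *)

Section Conclusion.

Variables (p : nat) (k : fieldType) (gT : finGroupType) (G : {group gT}).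
Hypotheses (pr_p : prime p) (pk : p \in [pchar k]) (isoG : p_isolated p G).

Lemma Fp_morphism : inhabited {rmorphism 'F_p -> k}.
Proof.
pose f (x : 'F_p) : k := (x : nat)%:R.
(* As [p] vanishes in [k], any natural number representing a residue may be used to compute [f]. *)
have fn n : f n%:R = n%:R.
  rewrite /f val_Fp_nat // [in RHS](divn_eq n p) natrD natrM (pcharf0 pk).
  by rewrite mulr0 add0r.
have fD x y : f (x + y) = f x + f y.
  by rewrite -[x in LHS]natr_Zp -[y in LHS]natr_Zp -natrD fn natrD.
have fB : zmod_morphism f by move=> x y; apply/esym/eqP; rewrite subr_eq -fD subrK.
have fM : monoid_morphism f.
  split=> [|x y]; first exact: (fn 1%N).
  by rewrite -[x in LHS]natr_Zp -[y in LHS]natr_Zp -natrM fn natrM.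
pose fB' := GRing.isZmodMorphism.Build 'F_p k f fB.
pose fM' := GRing.isMonoidMorphism.Build 'F_p k f fM.
by constructor; exact: (HB.pack_for {rmorphism 'F_p -> k} f fB' fM').
Qed.

Lemma ind_span_all (V : representation k G) : ind_span p (Rk_class V).
Proof.
have [phi] := Fp_morphism.
have [f [T1 [T2 [to1 [to2 [s1 s2 fE]]]]] f1] := split_char1 pr_p isoG.
have eqT : Rk_class (permrep to1 'F_p) = Rk_class (permrep (sum_act to2 (point_act G)) 'F_p).
  apply: Rk_class_permrep_eq => x Gx; rewrite fixnum_sum //.
  have -> : fixnum (point_act G) x = 1%N.
    by rewrite /fixnum -[RHS]card_unit; apply: eq_card => -[]; rewrite !inE mkactE.
  have /eqP := fE x Gx; rewrite f1 // -subr_eq opprK => /eqP.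
  by rewrite addrC => -[->].
have -> : Rk_class V = twist_Rk phi V (Rk_class (permrep to1 'F_p))
    - twist_Rk phi V (Rk_class (permrep to2 'F_p)).
  by rewrite -raddfB /= eqT Rk_class_permrep_sum addrC addKr Rk_class_twist_point.
have good (T : finType) (to : action G T) : p_split_act p to ->
    ind_span p (twist_Rk phi V (Rk_class (permrep to 'F_p))).
  move=> s; apply: ind_span_permrep => t; apply: ind_good_span => W.
  apply: (ind_span_p_split pr_p phi W pk _ (s t)).
  exact: p_isolatedS (subsetIl _ _) isoG.
by apply: ind_spanB; apply: good.
Qed.

(** A generator induced from [Q] comes from a family supported at [Q]; a projective generator
    vanishes in the stable group and comes from 0. *)
Lemma ind_sum_span (y : Rk k G) : ind_span p y ->
  exists x : (forall H : {H : {group gT} | H \in p_subgroups p G}, Sk k (sval H)),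
    ind_sum x = Sk_proj y.
Proof.
elim=> [_ [Q sQG U pQ | P prP] | | a b _ [xa xaE] _ [xb xbE]].
- have QpG : Q \in p_subgroups p G by rewrite inE sQG.
  pose Q' : {H : {group gT} | H \in p_subgroups p G} := exist _ Q QpG.
  pose z : forall H : {H : {group gT} | H \in p_subgroups p G}, Sk k (sval H) := fun=> 0.
  exists (dfwith z (Sk_proj (Rk_class U) : Sk k (sval Q'))).
  rewrite /ind_sum (bigD1 Q') //= dfwith_in big1 ?addr0 => [|H HQ].
    rewrite ind_SkE ind_RkE; congr (Sk_proj (Rk_class (ind_grepr _ _))).
    (* The two induced modules differ only in the proof that [Q] is contained in [G]. *)
    exact: eq_irrelevance.
  by rewrite dfwith_out ?raddf0 // eq_sym.
- exists (fun=> 0); rewrite /ind_sum big1 => [|H _]; last by rewrite raddf0.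
  apply/esym; rewrite -[RHS](raddf0 (@Sk_proj k gT G)).
  apply/quotz_pi_eq/zgen_gen; rewrite subr0.
  pose P' : projrep k G := exist _ P prP.
  by exists (groth_class _ P'); rewrite ?cartanE.
- by exists (fun=> 0); rewrite raddf0 /ind_sum big1 // => H _; rewrite raddf0.
exists (fun H => xa H - xb H).
have -> : Sk_proj (a - b) = Sk_proj a - Sk_proj b by rewrite raddfB.
by rewrite -xaE -xbE /ind_sum -sumrB; apply: eq_bigr => H _; rewrite raddfB.
Qed.

End Conclusion.

Theorem theorem3 (p : nat) (k : fieldType) (gT : finGroupType)
    (G : {group gT}) (hp : prime p) (hk : p \in [pchar k]%R)
    (hG : p_isolated p G) :
  forall y : Sk k G,
  exists x : (forall H : {H : {group gT} | H \in p_subgroups p G},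
                Sk k (sval H)),
    ind_sum x = y.
Proof.
(* [y] is lifted to the Grothendieck group of all modules, which is generated by the classes of
   modules. *)
move=> y; have [r <-] := quotz_pi_surj y; apply: ind_sum_span.
move: r; apply: groth_ind => [|a b Ja Jb|V].
- exact: zgen0.
- exact: ind_spanB.
exact: ind_span_all hp hk hG V.
Qed.
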